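(* Let $d_A=d_B=d_C=d_D\ge2$ and $V=\mathbb C^{d_A}\otimes\mathbb C^{d_B}\otimes\mathbb C^{d_C}\otimes\mathbb C^{d_D}$. Then the set of all $\psi\in V$ with $F_\theta(\psi)<F^\theta(\psi)$ for all $\theta\in\mathcal P^4_{\mathrm{lam}}\setminus\mathcal P^4_{\mathrm s}$ contains a Euclidean-open and (Euclidean-)dense subset of $V$.
   Context: **Bipartitions.** Here $k=4$ with legs denoted $A,B,C,D$. $V=V_1\otimes\cdots\otimes V_k$, $V_i=\mathbb C^{d_i}$ with standard inner product, $V_S=\bigotimes_{i\in S}V_i$. A bipartition of $[k]=\{1,\dots,k\}$ is an unordered pair $b=\{S,\overline S\}$ with $\emptyset\ne S\subsetneq[k]$, $\overline S=[k]\setminus S$; it is a singleton bipartition if $S$ or $\overline S$ has one element. Two bipartitions $\{S,\overline S\}$, $\{T,\overline T\}$ are mutually laminar if there are $X\in\{S,\overline S\}$, $Y\in\{T,\overline T\}$ with $X\subseteq Y$; a set of bipartitions is laminar if its members are pairwise mutually laminar. $\mathcal P^k_{\mathrm{lam}}$ is the set of probability distributions on bipartitions of $[k]$ with laminar support, and $\mathcal P^k_{\mathrm s}$ the set of those supported only on singleton bipartitions. **Lower quantum functional.** For $\psi\neq0$ let $\psi_S:V_{\overline S}^*\to V_S$ be the flattening, $\rho_S=\psi_S\psi_S^*/\|\psi\|_2^2$, $H_b(\psi)=H(\rho_S)$ the von Neumann entropy (base 2), $H_\theta=\sum_b\theta(b)H_b$, $E_\theta(\psi)=\sup_{A_j\in\mathrm{GL}(V_j)}H_\theta((A_1\otimes\cdots\otimes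 A_k)\psi)$, $F_\theta=2^{E_\theta}$, and $F_\theta(0)=0$. **Upper quantum functional.** For $n\ge1$ and $\lambda\vdash n$, let $P_\lambda^{V_S}$ be the projector on $V^{\otimes n}\cong V_S^{\otimes n}\otimes V_{\overline S}^{\otimes n}$ onto the $\lambda$-isotypic component of the symmetric group $S_n$ permuting the factors of $V_S^{\otimes n}$ (acting trivially on $V_{\overline S}^{\otimes n}$), $P_{(n)}^{V_{[k]}}$ the projector onto the symmetric subspace of $V^{\otimes n}$, and $P_\lambda^{V_b}=P_\lambda^{V_S}P_{(n)}^{V_{[k]}}$ for $b=\{S,\overline S\}$ (independent of the side; these commute for mutually laminar bipartitions). For $\theta\in\mathcal P^k_{\mathrm{lam}}$, $E^\theta(\psi)=\sup\sum_{b\in\mathrm{supp}\,\theta}\theta(b)H(\lambda^{(b)}/n)$ over all $n\ge1$ and tuples of partitions $\lambda^{(b)}\vdash n$ with $\big(\prod_{b\in\mathrm{supp}\,\theta}P^{V_b}_{\lambda^{(b)}}\big)\psi^{\otimes n}\ne0$, where $H$ is Shannon entropy (base 2); $F^\theta=2^{E^\theta}$, and $F^\theta(0)=0$. *)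

(* Defs.v *)
From mathcomp Require Import all_boot all_order all_algebra all_fingroup.
From mathcomp Require Import mxrepresentation complex.
From mathcomp Require Import boolp classical_sets reals topology normedtype exp.

Set Implicit Arguments.
Unset Strict Implicit.
Unset Printing Implicit Defensive.

Import Order.TTheory GRing.Theory Num.Theory.
Import numFieldNormedType.Exports.

Local Open Scope ring_scope.
Local Open Scope classical_set_scope.
Local Open Scope complex_scope.
Local Open Scope sesquilinear_scope.

Definition log2 (R : realType) (x : R) : R := ln x / ln 2.

(* [ln 0 = 0] in the library, so that 0 log 0 = 0. *)
Definition shannon (R : realType) (p : seq R) : R :=
  - \sum_(x <- p) x * log2 x.

(* [spectral_diag rho] lists the eigenvalues of the (normal) matrix rho,
   with multiplicity; for a density matrix they are real. *)
Definition von_neumann (R : realType) (n : nat) (rho : 'M[R[i]]_n) : R :=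
  shannon [seq complex.Re (spectral_diag rho 0 i) | i : 'I_n].

(* Vectors are row vectors of coordinates in the standard basis, whose elements
   are indexed (through enum_rank / enum_val) by a finite type of multi-indices.
   All k legs have the same dimension d. *)

Definition idx (k d : nat) := {ffun 'I_k -> 'I_d}.

Notation tensor R k d := 'rV[R[i]]_#|{: idx k d}| (only parsing).

Definition coord (R : realType) (T : finType) (v : 'rV[R[i]]_#|T|) (x : T) : R[i] :=
  v 0 (enum_rank x).

Definition sub_idx (k d : nat) (S : {set 'I_k}) := {ffun {j : 'I_k | j \in S} -> 'I_d}.

Definition res_idx (k d : nat) (S : {set 'I_k}) (m : idx k d) : sub_idx d S :=
  [ffun j => m (val j)].

(* Row indices: basis of V_S; column indices: basis of V_{~S}. The sum has
   exactly one term. *)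
Definition flattening (R : realType) (k d : nat) (S : {set 'I_k}) (psi : tensor R k d)
    : 'M[R[i]]_(#|{: sub_idx d S}|, #|{: sub_idx d (~: S)}|) :=
  \matrix_(i, j) \sum_(m : idx k d | (res_idx S m == enum_val i)
                                     && (res_idx (~: S) m == enum_val j)) coord psi m.

Definition sqnorm (R : realType) (n : nat) (v : 'rV[R[i]]_n) : R[i] :=
  \sum_i `|v 0 i| ^+ 2.

Definition density (R : realType) (k d : nat) (S : {set 'I_k}) (psi : tensor R k d)
    : 'M[R[i]]_#|{: sub_idx d S}| :=
  (sqnorm psi)^-1 *: (flattening S psi *m (flattening S psi)^t*).

Definition tensor_act (R : realType) (k d : nat) (A : 'I_k -> 'M[R[i]]_d)
    (psi : tensor R k d) : tensor R k d :=
  \row_i \sum_(m : idx k d) (\prod_j A j ((enum_val i : idx k d) j) (m j)) * coord psi m.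

Definition is_bipartition (k : nat) (b : {set {set 'I_k}}) : bool :=
  [exists S : {set 'I_k},
     [&& S != finset.set0, S != [set: 'I_k]%SET & b == [set S; (~: S)%SET]%SET]].

Definition bipartition (k : nat) := {b : {set {set 'I_k}} | is_bipartition b}.

(* An arbitrary side S of b; density (side b) psi has, up to zeros, the same
   spectrum for both sides, and bip_proj b is the same for both sides. *)
Definition side (k : nat) (b : bipartition k) : {set 'I_k} :=
  odflt finset.set0 [pick S in val b].

Definition singleton_bipartition (k : nat) (b : bipartition k) : bool :=
  [exists S in val b, #|S| == 1%N].

Definition mutually_laminar (k : nat) (b c : bipartition k) : bool :=
  [exists X in val b, [exists Y in val c, X \subset Y]].

Definition supp (R : realType) (k : nat) (theta : bipartition k -> R)
    : {set bipartition k} := [set b | theta b != 0]%SET.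

Definition is_distribution (R : realType) (k : nat) (theta : bipartition k -> R) : Prop :=
  (forall b, 0 <= theta b) /\ \sum_b theta b = 1.

Definition P_lam (R : realType) (k : nat) (theta : bipartition k -> R) : Prop :=
  is_distribution theta /\ {in supp theta &, forall b c, mutually_laminar b c}.

Definition P_s (R : realType) (k : nat) (theta : bipartition k -> R) : Prop :=
  is_distribution theta /\ {in supp theta, forall b, singleton_bipartition b}.

Definition H_bip (R : realType) (k d : nat) (b : bipartition k) (psi : tensor R k d) : R :=
  von_neumann (density (side b) psi).

Definition H_lower (R : realType) (k d : nat) (theta : bipartition k -> R)
    (psi : tensor R k d) : R :=
  \sum_b theta b * H_bip b psi.

Definition E_lower (R : realType) (k d : nat) (theta : bipartition k -> R)
    (psi : tensor R k d) : R :=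
  sup [set H_lower theta (tensor_act A psi)
      | A in [set A : 'I_k -> 'M[R[i]]_d | forall j, A j \in unitmx]].

Definition F_lower (R : realType) (k d : nat) (theta : bipartition k -> R)
    (psi : tensor R k d) : R :=
  if psi == 0 then 0 else 2 `^ E_lower theta psi.

(* The sum of an arbitrary family P of subspaces (row spaces) of F^N. *)
Lemma sum_family_subproof (F : fieldType) (N : nat) (P : 'M[F]_N -> Prop) :
  exists W : 'M[F]_N, forall X : 'M[F]_N,
    (W <= X)%MS <-> (forall U, P U -> (U <= X)%MS).
Proof.
pose Q r := `[< exists s : seq 'M[F]_N,
  (forall U, U \in s -> P U) /\ \rank (\sum_(U <- s) U)%MS = r >].
have Q0 : exists r, Q r.
  by exists (\rank (\sum_(U <- [::] : seq 'M[F]_N) U)%MS); apply/asboolP; exists [::].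
have Qub r : Q r -> (r <= N)%N.
  by move=> /asboolP[s [_ <-]]; exact: rank_leq_row.
case: (ex_maxnP Q0 Qub) => r /asboolP[s [sP rks]] rmax.
exists (\sum_(U <- s) U)%MS => X; split => [WX U PU|PX]; last first.
  rewrite big_seq; elim/big_ind : _ => [|A B AX BX|U Us]; first exact: sub0mx.
    by rewrite addsmx_sub AX.
  exact/PX/sP.
apply: submx_trans WX; have : (\sum_(U <- U :: s) U <= \sum_(U <- s) U)%MS.
  have sub : (\sum_(U <- s) U <= \sum_(U <- U :: s) U)%MS.
    by rewrite big_cons addsmxSr.
  rewrite -(geq_leqif (mxrank_leqif_sup sub)) rks; apply: rmax; apply/asboolP.
  by exists (U :: s); split=> // V; rewrite inE => /predU1P[->|/sP].
by apply: submx_trans; rewrite big_cons addsmxSl.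
Qed.

Definition sum_family (F : fieldType) (N : nat) (P : 'M[F]_N -> Prop) : 'M[F]_N :=
  sval (cid (sum_family_subproof P)).

Lemma sum_familyP (F : fieldType) (N : nat) (P : 'M[F]_N -> Prop) (X : 'M[F]_N) :
  (sum_family P <= X)%MS <-> (forall U, P U -> (U <= X)%MS).
Proof. exact: (svalP (cid (sum_family_subproof P))). Qed.

Definition is_part (n : nat) (lam : seq nat) : bool :=
  [&& sorted geq lam, 0%N \notin lam & sumn lam == n].

(* Row and column stabilizers of the tableau of shape lam filled in row by row:
   the cell of i : 'I_n is (reshape_index lam i, reshape_offset lam i). *)
Definition row_stab (n : nat) (lam : seq nat) : {set 'S_n} :=
  [set s : 'S_n | [forall i, reshape_index lam (s i) == reshape_index lam i]]%SET.

Definition col_stab (n : nat) (lam : seq nat) : {set 'S_n} :=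
  [set s : 'S_n | [forall i, reshape_offset lam (s i) == reshape_offset lam i]]%SET.

Definition young_symmetrizer (C : fieldType) (n : nat) (lam : seq nat)
    : 'rV[C]_#|[set: 'S_n]%SET| :=
  \sum_(p in row_stab n lam) \sum_(q in col_stab n lam)
     (-1) ^+ (q : bool) *: delta_mx 0 (gring_index [set: 'S_n]%G (p * q)%g).

(* The Specht module: the submodule of the regular representation generated by
   the Young symmetrizer. *)
Definition specht_mod (C : fieldType) (n : nat) (lam : seq nat)
    : 'M[C]_#|[set: 'S_n]%SET| :=
  cyclic_mx (regular_repr C [set: 'S_n]%G) (young_symmetrizer C n lam).

Definition specht_repr (C : fieldType) (n : nat) (lam : seq nat)
    : mx_representation C [set: 'S_n]%G (\rank (specht_mod C n lam)) :=
  submod_repr (cyclic_mx_module (regular_repr C [set: 'S_n]%G)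
                                (young_symmetrizer C n lam)).

Definition isotypic (C : fieldType) (n N : nat)
    (rG : mx_representation C [set: 'S_n]%G N) (lam : seq nat) : 'M[C]_N :=
  sum_family (fun U => exists modU : mxmodule rG U,
    mx_rsim (submod_repr modU) (specht_repr C n lam)).

Definition pow_idx (k d n : nat) := {ffun 'I_n -> idx k d}.

Definition tensor_power (R : realType) (k d n : nat) (psi : tensor R k d)
    : 'rV[R[i]]_#|{: pow_idx k d n}| :=
  \row_i \prod_(t < n) coord psi ((enum_val i : pow_idx k d n) t).

(* s moves the S-part of the t-th factor to the (s t)-th factor. *)
Definition permute_idx (k d n : nat) (S : {set 'I_k}) (s : 'S_n) (w : pow_idx k d n)
    : pow_idx k d n :=
  [ffun t => [ffun j => if j \in S then w ((s^-1)%g t) j else w t j]].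

Definition permute_mx (R : realType) (k d n : nat) (S : {set 'I_k}) (s : 'S_n)
    : 'M[R[i]]_#|{: pow_idx k d n}| :=
  \matrix_(i, j) (enum_val j == permute_idx S s (enum_val i))%:R.

Lemma permute_mx_repr (R : realType) (k d n : nat) (S : {set 'I_k}) :
  mx_repr [set: 'S_n]%G (@permute_mx R k d n S).
Proof.
split=> [|s u _ _]; apply/matrixP => i j; rewrite !mxE.
  suff -> : permute_idx S 1 (enum_val i) = enum_val i.
    by rewrite (inj_eq enum_val_inj) eq_sym.
  by apply/ffunP => t; apply/ffunP => l; rewrite !ffunE invg1 perm1 if_same.
rewrite (bigD1 (enum_rank (permute_idx S s (enum_val i)))) //= big1 ?addr0.
  rewrite !mxE enum_rankK eqxx mul1r; congr (_ == _)%:R.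
  apply/ffunP => t; apply/ffunP => l; rewrite !ffunE invMg permM.
  by case: ifP => // ->.
move=> l Hl; rewrite !mxE; case: eqP => [El|]; last by rewrite mul0r.
by rewrite -El enum_valK eqxx in Hl.
Qed.

Definition permute_repr (R : realType) (k d n : nat) (S : {set 'I_k}) :=
  MxRepresentation (@permute_mx_repr R k d n S).

(* The projectors act on row vectors by multiplication on the right. *)
Definition isotypic_proj (R : realType) (k d n : nat) (S : {set 'I_k}) (lam : seq nat)
    : 'M[R[i]]_#|{: pow_idx k d n}| :=
  proj_ortho (isotypic (permute_repr R d n S) lam).

Definition sym_proj (R : realType) (k d n : nat) : 'M[R[i]]_#|{: pow_idx k d n}| :=
  proj_ortho (rfix_mx (permute_repr R d n [set: 'I_k]%SET) [set: 'S_n]%SET).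

Definition bip_proj (R : realType) (k d n : nat) (b : bipartition k) (lam : seq nat)
    : 'M[R[i]]_#|{: pow_idx k d n}| :=
  sym_proj R k d n *m isotypic_proj R d n (side b) lam.

Definition part_entropy (R : realType) (n : nat) (lam : seq nat) : R :=
  shannon [seq (l%:R / n%:R : R) | l <- lam].

(* The projectors commute when theta has laminar support, so that the order of
   the product over the support does not matter. *)
Definition E_upper (R : realType) (k d : nat) (theta : bipartition k -> R)
    (psi : tensor R k d) : R :=
  sup [set h | exists n : nat, exists lam : bipartition k -> seq nat,
    [/\ (0 < n)%N,
        {in supp theta, forall b, is_part n (lam b)},
        tensor_power n psi
          *m \big[mulmx/1%:M]_(b in supp theta) bip_proj R d n b (lam b) != 0
      & h = \sum_(b in supp theta) theta b * part_entropy R n (lam b)]].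

Definition F_upper (R : realType) (k d : nat) (theta : bipartition k -> R)
    (psi : tensor R k d) : R :=
  if psi == 0 then 0 else 2 `^ E_upper theta psi.

(* Main.v *)
From mathcomp Require Import boolp classical_sets reals topology normedtype exp.
From mathcomp Require Import all_boot all_order all_algebra all_fingroup.
From mathcomp Require Import mxrepresentation complex mxtens ring lra.
Require Import Defs.

(** A distribution with laminar support that is not carried by singletons charges
    exactly one balanced bipartition b0, with two legs on each side, together with
    singleton bipartitions. Write M for the flattening of psi across b0, a square
    matrix of size d^2, and let the maximal value be the sum of theta(b) times the
    logarithm of the smaller of the two dimensions on the sides of b. For generic psi
    the upper functional attains this maximal value, and the lower one does not.

    Upper functional. The determinant of M is a polynomial of degree n = d^2 in psi
    that is invariant under the special linear group of each side of b0, hence under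
    that of each leg. Seen as a tensor in the n-th power of V, it is symmetric, of
    type (1^n) for b0 and of rectangular type (d^d) for each leg. So the projectors
    for these partitions, all of which have uniform entries, fix that tensor; and its
    pairing with the n-th power of psi is n! det M ([cell_vec_pairing]). When det M <>
    0 all these partitions are therefore admissible together ([E_upper_ge]). The
    supremum is moreover a real number, because a partition with more rows than the
    dimension of a side has no isotypic component there ([isotypic_size]).

    That the determinant lies in the isotypic component for a leg is checked directly
    on the Specht module generated by the Young symmetrizer: letting permutations act
    on a word whose stabilizer is the row stabilizer embeds that Specht module
    ([word_orbit_inj]), and the determinant is a combination of images of the Young
    symmetrizer ([biantisym_leg]). For the three complementary legs, the other side of
    the same singleton bipartition, this follows from a self-duality argument:
    contraction with the determinant, a real tensor, is an equivariant map which is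
    injective on the span of the slices ([biantisym_leg_compl]).

    Lower functional. If the entropy across b0 of A psi came arbitrarily close to 2
    log d, the flattening of A psi, rescaled, would come arbitrarily close to a
    unitary matrix. Let R(M) be the flattening of psi across another balanced
    bipartition and r(M) = det R(M) / det M. Then r(M) and r(M^-T) do not change when
    psi is replaced by A psi, since all determinants are multiplied by matching powers
    of the det A_j ([realign_ratio_act], [realign_ratio_inv_act]). A unitary U has
    U^-T equal to its conjugate, so that r(U^-T) is the conjugate of r(U). If M
    violates this identity, the whole orbit stays at a distance from the unitary
    matrices ([unitary_gap]), and the entropy stays at a distance from its maximum
    ([von_neumann_gap], [H_bip_gap]).

    Genericity. After clearing denominators, the condition on M says that a polynomial
    in the real and imaginary parts of psi does not vanish. It is not the zero
    polynomial: if SWAP exchanges the two factors and Omega is the matrix whose entry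
    at ((a, b), (c, e)) is 1 when a = b and c = e, and 0 otherwise, then M = SWAP +
    Omega has R(M) = SWAP + 1, which is singular, while M^-1 = SWAP - Omega / (1 + d)
    is realigned to the invertible SWAP - 1 / (1 + d). Such a condition defines an
    open dense set ([generic_set_open_dense]). *)

Set Implicit Arguments.
Unset Strict Implicit.
Unset Printing Implicit Defensive.

Import Order.TTheory GRing.Theory Num.Theory.
Import numFieldNormedType.Exports.
Local Open Scope ring_scope.
Local Open Scope sesquilinear_scope.

(** * Realignment and the orbit invariants *)

Lemma sum_mxtens (R : Type) (idx : R) (op : Monoid.com_law idx) (m n : nat)
    (f : 'I_(m * n) -> R) :
  \big[op/idx]_x f x = \big[op/idx]_i \big[op/idx]_j f (mxtens_index (i, j)).
Proof.
rewrite pair_big /=; apply: reindex; exists (@mxtens_unindex m n) => x _;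
  rewrite -surjective_pairing; by rewrite (mxtens_indexK, mxtens_unindexK).
Qed.

(** If M is the flattening of a four-leg tensor across (a b | c e), its realignment is
    the flattening across (a c | b e). *)
Definition realign (T : Type) (d : nat) (M : 'M[T]_(d * d)) : 'M[T]_(d * d) :=
  \matrix_(x, y) M (mxtens_index ((mxtens_unindex x).1, (mxtens_unindex y).1))
                   (mxtens_index ((mxtens_unindex x).2, (mxtens_unindex y).2)).

Lemma realignE (T : Type) (d : nat) (M : 'M[T]_(d * d)) a b c e :
  realign M (mxtens_index (a, c)) (mxtens_index (b, e)) =
  M (mxtens_index (a, b)) (mxtens_index (c, e)).
Proof. by rewrite mxE !mxtens_indexK. Qed.

Lemma matrix_tensP (T : Type) (m n p q : nat) (M N : 'M[T]_(m * n, p * q)) :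
  (forall a b c e, M (mxtens_index (a, b)) (mxtens_index (c, e))
                   = N (mxtens_index (a, b)) (mxtens_index (c, e))) -> M = N.
Proof.
move=> H; apply/matrixP => x y.
by case: (mxtens_indexP x) => a b; case: (mxtens_indexP y) => c e.
Qed.

Lemma tens_mulmxE (F : comPzRingType) (m n p q m' n' p' q' : nat)
    (A : 'M[F]_(m, p)) (B : 'M[F]_(n, q)) (M : 'M[F]_(p * q, p' * q'))
    (C : 'M[F]_(m', p')) (D : 'M[F]_(n', q')) a b c e :
  ((A *t B) *m M *m (C *t D)^T) (mxtens_index (a, b)) (mxtens_index (c, e)) =
  \sum_i \sum_j \sum_k \sum_l A a i * B b j * C c k * D e l
    * M (mxtens_index (i, j)) (mxtens_index (k, l)).
Proof.
rewrite -mulmxA mxE. rewrite sum_mxtens; apply: eq_bigr => i _; apply: eq_bigr => j _.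
rewrite [X in _ * X]mxE (@sum_mxtens _ _ _ p' q') mulr_sumr; apply: eq_bigr => k _.
rewrite mulr_sumr; apply: eq_bigr => l _.
by rewrite tensmxE [(_ *t _)^T _ _]mxE tensmxE; ring.
Qed.

Lemma realignD (F : nmodType) (d : nat) (A B : 'M[F]_(d * d)) :
  realign (A + B) = realign A + realign B.
Proof. by apply/matrixP => i j; rewrite !mxE. Qed.

Lemma realignZ (F : pzSemiRingType) (d : nat) (k : F) (A : 'M[F]_(d * d)) :
  realign (k *: A) = k *: realign A.
Proof. by apply/matrixP => i j; rewrite !mxE. Qed.

(** Both sides apply the four matrices to the four legs of the same tensor. *)
Lemma realign_act (F : comPzRingType) (d : nat) (A B C D : 'M[F]_d) (M : 'M[F]_(d * d)) :
  realign ((A *t B) *m M *m (C *t D)^T) = (A *t C) *m realign M *m (B *t D)^T.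
Proof.
apply: matrix_tensP => a c b e; rewrite realignE !tens_mulmxE.
apply: eq_bigr => i _; rewrite exchange_big; apply: eq_bigr => k _; apply: eq_bigr => j _.
by apply: eq_bigr => l _; rewrite realignE; ring.
Qed.

Definition tens_swap (F : pzSemiRingType) (d : nat) : 'M[F]_(d * d) :=
  \matrix_(x, y) (mxtens_unindex x == ((mxtens_unindex y).2, (mxtens_unindex y).1))%:R.

Lemma tens_swapE (F : pzSemiRingType) (d : nat) a b c e :
  tens_swap F d (mxtens_index (a, b)) (mxtens_index (c, e)) = ((a == e) && (b == c))%:R.
Proof. by rewrite mxE !mxtens_indexK. Qed.

Lemma tens_swap_tr (F : pzSemiRingType) (d : nat) : (tens_swap F d)^T = tens_swap F d.
Proof. by apply: matrix_tensP => a b c e; rewrite mxE !tens_swapE eq_sym andbC eq_sym. Qed.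

Lemma tens_swapM (F : comPzRingType) (d : nat) (M : 'M[F]_(d * d)) a b y :
  (tens_swap F d *m M) (mxtens_index (a, b)) y = M (mxtens_index (b, a)) y.
Proof.
rewrite mxE (@sum_mxtens _ _ _ d d) (bigD1 b) //= (bigD1 a) //= big1 => [|i ia]; last first.
  by rewrite tens_swapE [a == i]eq_sym (negPf ia) mul0r.
rewrite tens_swapE !eqxx mul1r addr0 big1 ?addr0 // => i ib; apply: big1 => j _.
by rewrite tens_swapE [b == i]eq_sym (negPf ib) andbF mul0r.
Qed.

Lemma tens_swapK (F : comPzRingType) (d : nat) : tens_swap F d *m tens_swap F d = 1%:M.
Proof.
apply: matrix_tensP => a b c e; rewrite tens_swapM tens_swapE mxE.
by rewrite (can_eq (@mxtens_indexK d d)) xpair_eqE andbC.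
Qed.

Lemma tens_swapC (F : comPzRingType) (d : nat) (A B : 'M[F]_d) :
  tens_swap F d *m (A *t B) *m tens_swap F d = B *t A.
Proof.
apply: matrix_tensP => a b c e.
rewrite -mulmxA tens_swapM -[X in (_ *m X)]tens_swap_tr -[_ *m _^T]trmxK trmx_mul trmxK mxE
  tens_swapM.
by rewrite mxE !tensmxE mulrC.
Qed.

(** Conjugation by the swap exchanges the tensor factors. *)
Lemma det_tensC (F : comUnitRingType) (d : nat) (A B : 'M[F]_d) :
  \det (A *t B) = \det (B *t A).
Proof.
by rewrite -[A *t B]tens_swapC !det_mulmx mulrC mulrA -det_mulmx tens_swapK det1 mul1r.
Qed.

(** Each leg matrix contributes the same factor to a flattening whichever other leg it
    is grouped with; this is what makes the factors cancel in [realign_ratio_act]. *)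
Lemma det_tens_split (F : comUnitRingType) (d : nat) (A B : 'M[F]_d) :
  \det (A *t B) = \det (A *t (1%:M : 'M_d)) * \det (B *t (1%:M : 'M_d)).
Proof. by rewrite tensmx_decr det_mulmx [in X in _ * X]det_tensC. Qed.

Section InvariantRatio.
Variables (F : fieldType) (d : nat).
Hypothesis d0 : d != 0%N.
Implicit Types M : 'M[F]_(d * d).

(** The ratio of two invariants with the same weight, hence invariant under the full
    linear groups of the legs. *)
Definition realign_ratio M : F := \det (realign M) / \det M.

Lemma det_act_neq0 (A B : 'M[F]_d) : A \in unitmx -> B \in unitmx -> \det (A *t B) != 0.
Proof. by move=> uA uB; rewrite -unitfE -unitmxE tensmx_unit. Qed.

Lemma realign_ratio_act (A B C D : 'M[F]_d) M :
  A \in unitmx -> B \in unitmx -> C \in unitmx -> D \in unitmx ->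
  realign_ratio ((A *t B) *m M *m (C *t D)^T) = realign_ratio M.
Proof.
move=> uA uB uC uD; rewrite /realign_ratio realign_act !det_mulmx !det_tr.
have h (X : 'M[F]_d) : X \in unitmx -> \det (X *t (1%:M : 'M_d)) != 0.
  by move=> uX; rewrite det_act_neq0 ?unitmx1.
have [[[hA hB] hC] hD] := (h _ uA, h _ uB, h _ uC, h _ uD).
rewrite [\det (A *t C)]det_tens_split [\det (B *t D)]det_tens_split [\det (A *t
  B)]det_tens_split [\det (C *t D)]det_tens_split.
have [->|M0] := eqVneq (\det M) 0; first by rewrite !(mul0r, mulr0, invr0).
by field; rewrite hA hB hC hD M0.
Qed.

(** The inverse transpose of a flattening is the flattening of a tensor on the dual
    legs, on which the four matrices act through their own inverse transposes. *)
Lemma realign_ratio_inv_act (A B C D : 'M[F]_d) M :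
  A \in unitmx -> B \in unitmx -> C \in unitmx -> D \in unitmx -> M \in unitmx ->
  realign_ratio (invmx ((A *t B) *m M *m (C *t D)^T))^T = realign_ratio (invmx M)^T.
Proof.
move=> uA uB uC uD uM.
have tinv (X Y : 'M[F]_d) : X \in unitmx -> Y \in unitmx ->
    invmx (X *t Y) = invmx X *t invmx Y.
  move=> uX uY; have u : (X *t Y) \in unitmx by rewrite tensmx_unit.
  rewrite -[LHS]mulmx1; apply: (canLR (mulKmx u)); rewrite tensmx_mul !mulmxV //.
  apply: matrix_tensP => a b c e; rewrite tensmxE !mxE.
  by rewrite (can_eq (@mxtens_indexK d d)) xpair_eqE -natrM mulnb.
have invM (X Y : 'M[F]_(d*d)) : X \in unitmx -> Y \in unitmx ->
    invmx (X *m Y) = invmx Y *m invmx X.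
  move=> uX uY; have u : (X *m Y) \in unitmx by rewrite unitmx_mul uX.
  by rewrite -[LHS]mulmx1; apply: (canLR (mulKmx u)); rewrite mulmxA -[X *m Y *m _]mulmxA
    mulmxV // mulmx1 mulmxV.
have uAB : (A *t B) \in unitmx by rewrite tensmx_unit.
have uCD : (C *t D) \in unitmx by rewrite tensmx_unit.
rewrite invM ?unitmx_mul ?uAB ?uM ?unitmx_tr // invM // !trmx_mul -trmx_inv !tinv // 2!trmx_tens.
by rewrite realign_ratio_act // unitmx_tr unitmx_inv.
Qed.

End InvariantRatio.

Section Witness.
Variables (F : numFieldType) (d : nat).
Hypothesis hd : (1 < d)%N.

(** The unnormalized rank-one projection onto the maximally entangled vector. *)
Definition omega_proj : 'M[F]_(d * d) :=
  \matrix_(x, y) (((mxtens_unindex x).1 == (mxtens_unindex x).2) &&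
                  ((mxtens_unindex y).1 == (mxtens_unindex y).2))%:R.

Lemma omega_projE a b c e :
  omega_proj (mxtens_index (a, b)) (mxtens_index (c, e)) = ((a == b) && (c == e))%:R.
Proof. by rewrite mxE !mxtens_indexK. Qed.

Lemma realign_omega : realign omega_proj = 1%:M.
Proof.
apply: matrix_tensP => a c b e.
by rewrite realignE omega_projE mxE (can_eq (@mxtens_indexK d d)) xpair_eqE.
Qed.

Lemma realign_swap : realign (tens_swap F d) = tens_swap F d.
Proof.
by apply: matrix_tensP => a c b e; rewrite realignE !tens_swapE [c == b]eq_sym.
Qed.

Lemma omega_proj_sq : omega_proj *m omega_proj = d%:R *: omega_proj.
Proof.
apply: matrix_tensP => a b c e; rewrite [RHS]mxE mxE (@sum_mxtens _ _ _ d d).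
rewrite (eq_bigr (fun=> ((a == b) && (c == e))%:R)) => [|i _].
  by rewrite sumr_const card_ord omega_projE mulr_natl.
rewrite (bigD1 i) //= big1 => [|j ji]; last by rewrite !omega_projE [i == j]eq_sym (negPf
  ji) andbF mul0r.
by rewrite !omega_projE eqxx andbT addr0 -natrM mulnb.
Qed.

Lemma swap_omega : tens_swap F d *m omega_proj = omega_proj.
Proof. by apply: matrix_tensP => a b c e; rewrite tens_swapM !omega_projE eq_sym. Qed.

Lemma omega_swap : omega_proj *m tens_swap F d = omega_proj.
Proof.
rewrite -[LHS]trmxK trmx_mul tens_swap_tr.
have tr : omega_proj^T = omega_proj.
  by apply: matrix_tensP => a b c e; rewrite mxE !omega_projE andbC.
by rewrite tr swap_omega tr.
Qed.

(** A matrix for which the invariant of [realign_ratio] vanishes, while that of the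
    inverse transpose does not. *)
Definition witness : 'M[F]_(d * d) := tens_swap F d + omega_proj.

Lemma witness_inv :
  witness *m (tens_swap F d - (d.+1%:R)^-1 *: omega_proj) = 1%:M.
Proof.
rewrite /witness mulmxDl !mulmxBr tens_swapK omega_swap -!scalemxAr swap_omega omega_proj_sq.
rewrite -[RHS]addr0 -addrA; congr (_ + _); apply/matrixP => i j.
move: omega_proj => w; rewrite !mxE; have : d.+1%:R != 0 :> F by rewrite pnatr_eq0.
by rewrite -natr1 => d1; field.
Qed.

Lemma witness_unit : witness \in unitmx.
Proof. by have /mulmx1_unit[] := witness_inv. Qed.

Lemma invmx_witness : invmx witness = tens_swap F d - (d.+1%:R)^-1 *: omega_proj.
Proof. by rewrite -[LHS]mulmx1 -witness_inv mulKmx ?witness_unit. Qed.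

(** The realignment, the swap plus the identity, has two equal rows. *)
Lemma realign_ratio_witness : realign_ratio witness = 0.
Proof.
rewrite /realign_ratio /witness realignD realign_swap realign_omega.
set M := _ + _; suff -> : \det M = 0 by rewrite mul0r.
pose i0 : 'I_d := Ordinal (ltnW hd); pose i1 : 'I_d := Ordinal hd.
pose x := mxtens_index (i0, i1); pose y := mxtens_index (i1, i0).
apply: (@determinant_alternate _ _ M x y).
  by rewrite (can_eq (@mxtens_indexK d d)).
move=> z; case: (mxtens_indexP z) => c e; rewrite !mxE !mxtens_indexK.
rewrite !(can_eq (@mxtens_indexK d d)) !xpair_eqE /= [LHS]addrC.
by congr (_%:R + _%:R); rewrite andbC.
Qed.

(** With c = 1 / (d + 1), the product of SWAP - c and SWAP + c is the scalar 1 - c^2,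
    which is not zero. *)
Lemma realign_ratio_inv_witness : realign_ratio (invmx witness)^T != 0.
Proof.
have uW := witness_unit; rewrite /realign_ratio mulf_neq0 //; last first.
  by rewrite invr_eq0 -unitfE -unitmxE unitmx_tr unitmx_inv.
set c : F := (d.+1%:R)^-1.
have c1 : 1 - c ^+ 2 != 0.
  rewrite lt0r_neq0 // subr_gt0 expr_lt1 //; last by rewrite invr_ge0 ler0n.
  by rewrite invf_lt1 ?ltr0n // ltr1n ltnS ltnW.
have -> : (invmx witness)^T = tens_swap F d - c *: omega_proj.
  rewrite invmx_witness; apply: matrix_tensP => a b e f; rewrite !mxE !mxtens_indexK /=.
  by rewrite !xpair_eqE [f == a]eq_sym [e == b]eq_sym andbC [(_ == _) && (a == b)]andbC.
rewrite -scaleNr realignD realignZ realign_swap realign_omega scaleNr.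
have : (tens_swap F d - c *: 1%:M) *m (tens_swap F d + c *: 1%:M) = (1 - c ^+ 2) *: 1%:M.
  rewrite mulmxDr !mulmxBl tens_swapK -!scalemxAr -!scalemxAl !mulmx1 !mul1mx.
  by rewrite addrA subrK scalerBl scale1r scalerA -expr2.
move/(congr1 determinant); rewrite det_mulmx detZ det1 mulr1 => h.
by have : (1 - c ^+ 2) ^+ (d * d) != 0 := expf_neq0 _ c1; rewrite -h mulf_eq0 negb_or => /andP[].
Qed.

End Witness.

(** * Approximately unitary matrices *)

Section Frobenius.
Variable C : numClosedFieldType.

Definition frob (m n : nat) (W : 'M[C]_(m, n)) : C := \sum_i \sum_j `|W i j| ^+ 2.

Lemma trmxC_mul p q r (A : 'M[C]_(p, q)) (B : 'M[C]_(q, r)) : (A *m B)^t* = B^t* *m A^t*.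
Proof. by rewrite trmx_mul map_mxM. Qed.

Lemma frob_trace m n (F : 'M[C]_(m, n)) : frob F = \tr (F *m F^t*).
Proof.
by apply: eq_bigr => i _; rewrite mxE; apply: eq_bigr => j _; rewrite !mxE normCK.
Qed.

Lemma frob_eq0 m n (F : 'M[C]_(m, n)) : (frob F == 0) = (F == 0).
Proof.
apply/eqP/eqP => [|->]; last by rewrite /frob big1 // => i _; rewrite big1 // => j _;
  rewrite mxE normr0 expr0n.
move=> h; apply/matrixP => i j; rewrite mxE; apply/eqP; rewrite -normr_eq0 -sqrf_eq0.
have /psumr_eq0P /(_ h) /(_ i isT) : forall i, true -> 0 <= \sum_j `|F i j| ^+ 2.
  by move=> k _; apply: sumr_ge0 => l _; rewrite exprn_ge0.
by move/psumr_eq0P => -> // k _; rewrite exprn_ge0.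
Qed.

Lemma frob_ge0 m n (F : 'M[C]_(m, n)) : 0 <= frob F.
Proof. by do 2![apply: sumr_ge0 => ? _]; rewrite exprn_ge0. Qed.

Lemma le_frob m n (M : 'M[C]_(m, n)) i j : `|M i j| ^+ 2 <= frob M.
Proof.
rewrite /frob (bigD1 i) //= (bigD1 j) //= -addrA lerDl addr_ge0 //.
  by apply: sumr_ge0 => k _; rewrite exprn_ge0.
by do 2![apply: sumr_ge0 => ? _]; rewrite exprn_ge0.
Qed.

Lemma frobZ m n (t : C) (M : 'M[C]_(m, n)) : frob (t *: M) = `|t| ^+ 2 * frob M.
Proof.
rewrite /frob mulr_sumr; apply: eq_bigr => i _; rewrite mulr_sumr; apply: eq_bigr => j _.
by rewrite mxE normrM exprMn.
Qed.

Lemma frob_reindex m n p q (f : 'I_p -> 'I_m) (g : 'I_q -> 'I_n) (M : 'M[C]_(m, n)) :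
  bijective f -> bijective g -> frob M = frob (\matrix_(i, j) M (f i) (g j)).
Proof.
move=> bf bg; rewrite /frob (reindex f); last exact: onW_bij.
apply: eq_bigr => i _; rewrite (reindex g); last exact: onW_bij.
by apply: eq_bigr => j _; rewrite mxE.
Qed.

Lemma invmx_scale n (t : C) (M : 'M[C]_n) : t != 0 -> M \in unitmx ->
  invmx (t *: M) = t^-1 *: invmx M.
Proof.
move=> t0 uM; have u : t *: M \in unitmx by rewrite unitmxZ // unitfE.
rewrite -[LHS]mulmx1; apply: (canLR (mulKmx u)).
by rewrite -scalemxAl -scalemxAr scalerA divff // scale1r mulmxV.
Qed.

Lemma unitmx_neq0 n (M : 'M[C]_n) : (0 < n)%N -> M \in unitmx -> M != 0.
Proof.
case: n M => // n M _; apply: contraTneq => ->.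
by rewrite unitmxE det0 unitr0.
Qed.

End Frobenius.

Section Approx.
Variables (C : numClosedFieldType) (T : Type) (D : T -> Prop) (e : T -> C).
Hypothesis e_ge0 : forall x, D x -> 0 <= e x.

(** Congruence, in the ring of bounded functions on D, modulo the functions that are
    bounded by a multiple of e. It is compatible with all polynomial operations, so that
    error estimates can be replaced by algebra. *)
Definition approx (F G : T -> C) : Prop :=
  exists2 K : C, 0 <= K &
    forall x, D x -> [/\ `|F x| <= K, `|G x| <= K & `|F x - G x| <= K * e x].

Lemma approx_refl F K : (forall x, D x -> `|F x| <= K) -> approx F F.
Proof.
move=> FK; exists `|K| => // x Dx; rewrite subrr normr0 mulr_ge0 ?e_ge0 //.
have K0 : 0 <= K by apply: le_trans (FK _ Dx).
by rewrite [`|K|]ger0_norm // FK.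
Qed.

Lemma approx_cst c : approx (fun=> c) (fun=> c).
Proof. exact: (@approx_refl _ `|c|). Qed.

Lemma approx_ext F F' G G' : approx F G -> (forall x, D x -> F x = F' x) ->
  (forall x, D x -> G x = G' x) -> approx F' G'.
Proof.
move=> [K K0 FG] FF GG; exists K => // x Dx.
by rewrite -FF // -GG //; apply: FG.
Qed.

Lemma approxC F G : approx F G -> approx G F.
Proof. by move=> [K K0 FG]; exists K => // x /FG[? ? ?]; split=> //; rewrite distrC. Qed.

Lemma approx_trans F G H : approx F G -> approx G H -> approx F H.
Proof.
move=> [K K0 FG] [L L0 GH]; exists (K + L); first exact: addr_ge0.
move=> x Dx; have [f _ fg] := FG _ Dx; have [_ h gh] := GH _ Dx; split.
- by rewrite (le_trans f) // lerDl.
- by rewrite (le_trans h) // lerDr.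
by rewrite mulrDl (le_trans (ler_distD (G x) _ _)) // lerD.
Qed.

Lemma approxD F G F' G' : approx F G -> approx F' G' ->
  approx (fun x => F x + F' x) (fun x => G x + G' x).
Proof.
move=> [K K0 FG] [L L0 GH]; exists (K + L); first exact: addr_ge0.
move=> x Dx; have [f g fg] := FG _ Dx; have [f' g' fg'] := GH _ Dx; split.
- by rewrite (le_trans (ler_normD _ _)) // lerD.
- by rewrite (le_trans (ler_normD _ _)) // lerD.
by rewrite opprD addrACA mulrDl (le_trans (ler_normD _ _)) // lerD.
Qed.

Lemma approxM F G F' G' : approx F G -> approx F' G' ->
  approx (fun x => F x * F' x) (fun x => G x * G' x).
Proof.
move=> [K K0 FG] [L L0 GH]; exists (K * L + K * L); first by rewrite addr_ge0 ?mulr_ge0.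
have KL : K * L <= K * L + K * L by rewrite lerDl mulr_ge0.
move=> x Dx; have [f g fg] := FG _ Dx; have [f' g' fg'] := GH _ Dx; split.
- by rewrite normrM (le_trans _ KL) // ler_pM.
- by rewrite normrM (le_trans _ KL) // ler_pM.
have -> : F x * F' x - G x * G' x = F x * (F' x - G' x) + (F x - G x) * G' x by ring.
rewrite [X in _ <= X]mulrDl (le_trans (ler_normD _ _)) // !normrM lerD //.
  by rewrite -mulrA ler_pM.
by rewrite mulrAC ler_pM.
Qed.

Lemma approx_conj F G : approx F G -> approx (fun x => (F x)^*) (fun x => (G x)^*).
Proof.
move=> [K K0 FG]; exists K => // x Dx; have [f g fg] := FG _ Dx.
by rewrite -rmorphB !norm_conjC.
Qed.

Lemma approx_sum (I : Type) (r : seq I) (P : pred I) (F G : I -> T -> C) :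
  (forall i, approx (F i) (G i)) ->
  approx (fun x => \sum_(i <- r | P i) F i x) (fun x => \sum_(i <- r | P i) G i x).
Proof.
move=> FG; elim: r => [|i r IH].
  by apply: (approx_ext (approx_cst 0)) => x _; rewrite big_nil.
case Pi: (P i); last by apply: (approx_ext IH) => x _; rewrite big_cons Pi.
by apply: (approx_ext (approxD (FG i) IH)) => x _; rewrite big_cons Pi.
Qed.

Lemma approx_prod (I : Type) (r : seq I) (P : pred I) (F G : I -> T -> C) :
  (forall i, approx (F i) (G i)) ->
  approx (fun x => \prod_(i <- r | P i) F i x) (fun x => \prod_(i <- r | P i) G i x).
Proof.
move=> FG; elim: r => [|i r IH].
  by apply: (approx_ext (approx_cst 1)) => x _; rewrite big_nil.
case Pi: (P i); last by apply: (approx_ext IH) => x _; rewrite big_cons Pi.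
by apply: (approx_ext (approxM (FG i) IH)) => x _; rewrite big_cons Pi.
Qed.

Lemma approx_exp F G n : approx F G -> approx (fun x => F x ^+ n) (fun x => G x ^+ n).
Proof.
move=> FG; have := @approx_prod _ (iota 0 n) xpredT (fun=> F) (fun=> G) (fun=> FG).
by move/approx_ext; apply => x _; rewrite big_const_seq count_predT size_iota -Monoid.iteropE.
Qed.

Lemma approx_det n (F G : T -> 'M[C]_n) :
  (forall i j, approx (fun x => F x i j) (fun x => G x i j)) ->
  approx (fun x => \det (F x)) (fun x => \det (G x)).
Proof.
move=> FG; apply: approx_sum => s; apply: approxM; first exact: approx_cst.
exact: approx_prod.
Qed.

Lemma approx_adj n (F G : T -> 'M[C]_n) :
  (forall i j, approx (fun x => F x i j) (fun x => G x i j)) ->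
  forall i j, approx (fun x => (\adj (F x)) i j) (fun x => (\adj (G x)) i j).
Proof.
move=> FG i j.
have : approx (fun x => cofactor (F x) j i) (fun x => cofactor (G x) j i).
  apply: approxM; first exact: approx_cst.
  by apply: approx_det => k l; apply: (approx_ext (FG (lift j k) (lift i l))) => x _; rewrite !mxE.
by move/approx_ext; apply => x _; rewrite mxE.
Qed.

Lemma approx_mulmx m n p (F G : T -> 'M[C]_(m, n)) (F' G' : T -> 'M[C]_(n, p)) :
  (forall i j, approx (fun x => F x i j) (fun x => G x i j)) ->
  (forall i j, approx (fun x => F' x i j) (fun x => G' x i j)) ->
  forall i j, approx (fun x => (F x *m F' x) i j) (fun x => (G x *m G' x) i j).
Proof.
move=> FG FG' i j.
have : approx (fun x => \sum_k F x i k * F' x k j) (fun x => \sum_k G x i k * G' x k j).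
  by apply: approx_sum => k; apply: approxM.
by move/approx_ext; apply => x _; rewrite mxE.
Qed.

End Approx.

Section Gap.
Variables (C : numClosedFieldType) (d : nat) (r r' : C).
Hypothesis d0 : (0 < d)%N.
Hypothesis rr' : r' != r^*.
Local Notation N := (d * d)%N.
Implicit Types W : 'M[C]_N.

(** Pairs of a normalized matrix with prescribed invariants and a bound on its distance
    to the unitary matrices. *)
Definition gap_dom (x : 'M[C]_N * C) : Prop :=
  [/\ 0 <= x.2, x.1 \in unitmx, frob x.1 = N%:R,
      forall i j, `|(x.1 *m x.1^t* - 1%:M) i j| <= x.2 &
      realign_ratio x.1 = r /\ realign_ratio (invmx x.1)^T = r'].

(** Modulo the distance to the unitary matrices, the product W W^* is 1, so that adj W
    is det W times W^*; the inverse of W, which need not be bounded, is avoided by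
    working with adj W. With D = det W, comparing determinants of realignments gives
    r' D^(N-1) = r^* D^N D^*, and multiplying by the (N-1)-st power of D^* leaves
    r' = r^* because |D|^2 is 1. *)
Lemma approx_ratio : approx gap_dom snd (fun=> r') (fun=> r^*).
Proof.
have e0 x : gap_dom x -> 0 <= x.2 by case.
have N0 : (0 < N)%N by rewrite muln_gt0 d0.
have exN (z : C) : z ^+ N = z * z ^+ N.-1 by rewrite -exprS prednK.
set nr := approx gap_dom snd.
have nW i j : nr (fun x => x.1 i j) (fun x => x.1 i j).
  apply: (@approx_refl _ _ _ _ e0 _ N%:R) => x [_ _ fx _ _].
  have N1 : 1 <= N%:R :> C by rewrite ler1n muln_gt0 d0.
  rewrite -(@ler_pXn2r _ 2) ?nnegrE ?ler0n // (@le_trans _ _ N%:R) //; last first.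
    by rewrite expr2 ler_peMl // ler0n.
  by rewrite -fx le_frob.
have nWt i j : nr (fun x => x.1^t* i j) (fun x => x.1^t* i j).
  by apply: (approx_ext (approx_conj (nW j i))) => x _; rewrite !mxE.
have nWW i j : nr (fun x => (x.1 *m x.1^t*) i j) (fun=> (1%:M : 'M_N) i j).
  have [K K0 HK] : nr (fun x => (x.1 *m x.1^t*) i j) (fun x => (x.1 *m x.1^t*) i j).
    exact: (approx_mulmx e0 nW nWt).
  exists (K + 1); first by rewrite addr_ge0.
  move=> x Dx; have [k _ _] := HK _ Dx; split.
  - by rewrite (le_trans k) // lerDl.
  - by rewrite mxE; case: (i == j); rewrite ?normr1 ?normr0 ?lerDr ?addr_ge0.
  case: Dx => x0 _ _ /(_ i j); rewrite mxE [X in _ + X]mxE => h _.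
  by rewrite (le_trans h) // mulrDl mul1r lerDr mulr_ge0.
have nadj i j : nr (fun x => (\adj x.1) i j) (fun x => \det x.1 * (x.1 j i)^*).
  have : nr (fun x => (\adj x.1 *m 1%:M) i j) (fun x => (\adj x.1 *m (x.1 *m x.1^t*)) i j).
    apply: (approx_mulmx e0) => k l; last exact: approxC (nWW k l).
    exact: (approx_adj e0 nW).
  move/approx_ext; apply => x _; first by rewrite mulmx1.
  by rewrite mulmxA mul_adj_mx mul_scalar_mx !mxE.
have nD : nr (fun x => \det x.1 * (\det x.1)^*) (fun=> 1).
  apply: (approx_ext (approx_det e0 nWW)) => x _; last by rewrite det1.
  by rewrite det_mulmx det_map_mx det_tr.
have ndet : nr (fun x => \det x.1) (fun x => \det x.1) by exact: (approx_det e0 nW).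
have key : nr (fun x => r' * \det x.1 ^+ N.-1) (fun x => \det x.1 ^+ N * (r * \det x.1)^*).
  have : nr (fun x => \det (realign (\adj x.1)^T))
            (fun x => \det (realign (\det x.1 *: map_mx Num.conj x.1))).
    apply: (approx_det e0) => i j.
    pose a := mxtens_index ((mxtens_unindex i).1, (mxtens_unindex j).1).
    pose b := mxtens_index ((mxtens_unindex i).2, (mxtens_unindex j).2).
    by apply: (approx_ext (nadj b a)) => x _; rewrite !mxE.
  move/approx_ext; apply => x [_ uW _ _ [rx rx']].
    have dx : \det x.1 != 0 by rewrite -unitfE -unitmxE.
    have -> : \adj x.1 = \det x.1 *: invmx x.1.
      by rewrite /invmx uW scalerA divff // scale1r.
    rewrite linearZ /= realignZ detZ -rx' /realign_ratio det_tr det_inv invrK.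
    by rewrite exN; ring.
  have dx : \det x.1 != 0 by rewrite -unitfE -unitmxE.
  have -> : realign (\det x.1 *: map_mx Num.conj x.1) = \det x.1 *: map_mx Num.conj (realign x.1).
    by apply/matrixP => i j; rewrite !mxE.
  by rewrite detZ det_map_mx -rx /realign_ratio divfK.
have key2 : nr (fun x => r' * (\det x.1 * (\det x.1)^*) ^+ N.-1)
               (fun x => r^* * (\det x.1 * (\det x.1)^*) ^+ N).
  have h := approxM key (approx_exp e0 N.-1 (approx_conj ndet)). apply: (approx_ext h) => x _.
    by rewrite exprMn mulrA.
  by rewrite !exN exprMn rmorphM /=; ring.
apply: (approx_trans (approxC _)); last apply: (approx_trans key2).
  apply: (approx_ext (approxM (approx_cst e0 r') (approx_exp e0 N.-1 nD))) => // x _.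
  by rewrite expr1n mulr1.
apply: (approx_ext (approxM (approx_cst e0 _) (approx_exp e0 N nD))) => // x _.
by rewrite expr1n mulr1.
Qed.

(** [approx_ratio] says that the constant |r' - r^*| is at most K times the distance to
    the unitary matrices. *)
Lemma unitary_gap : exists2 e0 : C, 0 < e0 & forall W,
  W \in unitmx -> frob W = N%:R -> realign_ratio W = r ->
  realign_ratio (invmx W)^T = r' ->
  exists i j, e0 <= `|(W *m W^t* - 1%:M) i j|.
Proof.
have [K K0 HK] := approx_ratio.
have dr : 0 < `|r' - r^*| by rewrite normr_gt0 subr_eq0.
pose e0 := `|r' - r^*| / (K + 1).
have K1 : 0 < K + 1 by rewrite ltr_wpDl.
have e00 : 0 < e0 by rewrite divr_gt0.
exists e0 => // W uW fW rW rW'.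
have [/existsP[i /existsP[j ij]]|/existsPn Nh] :=
  boolP [exists i, exists j, ~~ (`|(W *m W^t* - 1%:M) i j| < e0)].
  by exists i, j; rewrite real_leNgt // ?normr_real // gtr0_real.
have [|_ _] := HK (W, e0).
  split=> //=; first exact: ltW.
  by move=> i j; have /existsPn/(_ j) := Nh i; rewrite negbK => /ltW.
have lt : K * e0 < `|r' - r^*|.
  by rewrite /e0 mulrCA gtr_pMr // ltr_pdivrMr // mul1r ltrDl.
by move=> /= le; have := lt_le_trans lt le; rewrite ltxx.
Qed.

End Gap.

(** * Entropy of a Gram matrix *)

Section Spectrum.
Variables (C : numClosedFieldType).

Variables (m n : nat) (F : 'M[C]_(m, n)).
Hypothesis F0 : F != 0.
Let rho := (frob F)^-1 *: (F *m F^t*).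
Let P := spectralmx rho.
Let sd := spectral_diag rho.

Lemma gram_herm : rho^t* = rho.
Proof.
rewrite /rho linearZ /= map_mxZ trmxC_mul trmxCK; congr (_ *: _).
by rewrite -[LHS]/((frob F)^-1)^* geC0_conj // invr_ge0 frob_ge0.
Qed.

Lemma gram_spectral : rho = P^t* *m diag_mx sd *m P.
Proof.
have /orthomx_spectralP h : rho \is normalmx by apply/normalmxP; rewrite gram_herm.
by rewrite {1}h invmx_unitary // spectral_unitarymx.
Qed.

Lemma gram_diag : diag_mx sd = (frob F)^-1 *: ((P *m F) *m (P *m F)^t*).
Proof.
have uP : P \is unitarymx := spectral_unitarymx rho.
have PP : P *m P^t* = 1%:M by apply/unitarymxP.
have -> : diag_mx sd = P *m rho *m P^t*.
  by rewrite gram_spectral -!mulmxA PP mulmx1 mulmxA PP mul1mx.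
by rewrite /rho -scalemxAr -scalemxAl trmxC_mul !mulmxA.
Qed.

Lemma spectral_ge0 i : 0 <= sd 0 i.
Proof.
have -> : sd 0 i = diag_mx sd i i by rewrite mxE eqxx mulr1n.
rewrite gram_diag mxE mulr_ge0 ?invr_ge0 ?frob_ge0 //; move: (P *m F) => G.
by rewrite mxE sumr_ge0 // => j _; rewrite [X in _ * X]mxE [X in _ * X^*]mxE mul_conjC_ge0.
Qed.

Lemma spectral_sum : \sum_i sd 0 i = 1.
Proof.
rewrite -mxtrace_diag gram_diag trmxC_mul mulmxA linearZ /= mxtrace_mulC !mulmxA.
have uP : P \is unitarymx := spectral_unitarymx rho.
have -> : P^t* *m P = 1%:M by apply: mulmx1C; apply/unitarymxP.
by rewrite mul1mx -frob_trace mulVf // frob_eq0.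
Qed.

Lemma spectral_sqr : \sum_i sd 0 i ^+ 2 = frob rho.
Proof.
have uP : P \is unitarymx := spectral_unitarymx rho.
have PP : P *m P^t* = 1%:M by apply/unitarymxP.
rewrite frob_trace gram_herm {1 2}gram_spectral -!mulmxA mxtrace_mulC -!mulmxA PP mulmx1.
rewrite (mulmxA P) PP mul1mx mulmx_diag mxtrace_diag.
by apply: eq_bigr => i _; rewrite mxE expr2.
Qed.

(** The rows of P F that belong to non-zero eigenvalues have a diagonal invertible Gram
    matrix, so that they are at most n in number. *)
Lemma spectral_card : (#|[pred i | sd 0%R i != 0%R]| <= n)%N.
Proof.
set A := [pred i | _]; pose f (k : 'I_#|A|) : 'I_m := enum_val k.
pose G := rowsub f (P *m F).
have E : mxsub f f (diag_mx sd) = ((frob F)^-1 *: G) *m G^t*.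
  rewrite gram_diag; apply/matrixP => k l; rewrite -scalemxAl !mxE; congr (_ * _).
  by apply: eq_bigr => j _; rewrite !mxE.
have u : mxsub f f (diag_mx sd) \in unitmx.
  rewrite unitmxE; have -> : mxsub f f (diag_mx sd) = diag_mx (\row_k sd 0 (f k)).
    by apply/matrixP => k l; rewrite !mxE (inj_eq enum_val_inj).
  rewrite det_diag unitfE; apply/prodf_neq0 => k _; rewrite mxE.
  by have := enum_valP k; rewrite inE.
have := mxrank_unit u; rewrite E => <-.
exact: leq_trans (mxrankM_maxl _ _) (rank_leq_col _).
Qed.

End Spectrum.

Section Entropy.
Variable R : realType.
Implicit Types x y : R.

Lemma ln2_gt0 : 0 < ln 2 :> R.
Proof. by rewrite ln_gt0 // ltr1n. Qed.

Lemma ln_ge1V y : 0 < y -> 1 - y^-1 <= ln y.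
Proof.
move=> y0; have yV : 0 < y^-1 by rewrite invr_gt0.
rewrite -[leRHS]opprK -lnV ?posrE // lerBlDr -lerBlDl opprK.
have -> : y^-1 = 1 + (y^-1 - 1) by rewrite addrC subrK.
rewrite lerD2l; apply: le_ln1Dx; rewrite ltrBDr; lra.
Qed.

Lemma shannon_image (I : finType) (p : I -> R) :
  shannon [seq p i | i : I] = - (\sum_i p i * ln (p i)) / ln 2.
Proof.
rewrite /shannon big_image /= mulNr mulr_suml; congr (- _).
by apply: eq_bigr => i _; rewrite /log2 mulrA.
Qed.

(** The tangent bound 1 - 1 / (x k) <= ln (x k), in a form that holds at 0 too. *)
Lemma xlnx_ge x k : 0 <= x -> 0 < k -> (x - (x != 0)%:R / k) - x * ln k <= x * ln x.
Proof.
move=> x0 k0; have [->|xn0] := eqVneq x 0; first by rewrite !mul0r !subr0.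
have xp : 0 < x by rewrite lt_def xn0.
rewrite /= mul1r -lerBrDr opprK -mulrDr -lnM ?posrE //.
have -> : x - k^-1 = x * (1 - (x * k)^-1) by field; rewrite xn0 gt_eqF.
by rewrite ler_pM2l // ln_ge1V // mulr_gt0.
Qed.

(** Gibbs' inequality against the uniform distribution on k points. *)
Lemma shannon_le_log (I : finType) (p : I -> R) (k : nat) : (0 < k)%N ->
  (forall i, 0 <= p i) -> \sum_i p i = 1 -> (#|[pred i | p i != 0%R]| <= k)%N ->
  shannon [seq p i | i : I] <= log2 k%:R.
Proof.
move=> k0 p0 p1 pk; rewrite shannon_image /log2 ler_pM2r ?invr_gt0 ?ln2_gt0 //.
rewrite lerNl; have kp : 0 < k%:R :> R by rewrite ltr0n.
have : \sum_i ((p i - (p i != 0)%:R / k%:R) - p i * ln k%:R) <= \sum_i p i * ln (p i).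
  by apply: ler_sum => i _; apply: xlnx_ge.
apply: le_trans; rewrite !sumrB -!mulr_suml p1 mul1r.
suff : (\sum_i (p i != 0)%:R) / k%:R <= 1 :> R by lra.
rewrite ler_pdivrMr // mul1r -natr_sum ler_nat (leq_trans _ pk) //.
by rewrite -sum1_card [leqRHS]big_mkcond /= leq_sum // => i _; rewrite inE; case: (p i != 0).
Qed.

(** Applying 1 - 1 / s <= ln s to the square root of y instead of y yields a
    second-order bound. *)
Lemma xlnx_sqrt y : 0 <= y -> (y - 1) + (Num.sqrt y - 1) ^+ 2 <= y * ln y.
Proof.
move=> y0; have [->|yn0] := eqVneq y 0; first by rewrite sqrtr0 mul0r; lra.
set s := Num.sqrt y; have s0 : 0 < s by rewrite sqrtr_gt0 lt_def yn0.
have -> : y = s ^+ 2 by rewrite sqr_sqrtr.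
rewrite lnXn // mulr2n; have := ln_ge1V s0.
rewrite -(@ler_pM2l _ (2 * s ^+ 2)) ?mulr_gt0 ?exprn_gt0 //.
have -> : 2 * s ^+ 2 * (1 - s^-1) = s ^+ 2 - 1 + (s - 1) ^+ 2 by field; rewrite gt_eqF.
by move/le_trans; apply; rewrite le_eqVlt; apply/orP; left; apply/eqP; ring.
Qed.

(** The deficit of entropy controls the squared distance to the uniform distribution.
    In natural units and with y_i = m p_i, [xlnx_sqrt] bounds it below by the sum of the
    (sqrt y_i - 1)^2 / m, and sqrt y_i + 1 is at most sqrt m + 1. *)
Lemma shannon_gap (m : nat) : (0 < m)%N -> exists2 c : R, 0 < c &
  forall p : 'I_m -> R, (forall i, 0 <= p i) -> \sum_i p i = 1 ->
  shannon [seq p i | i : 'I_m] <= log2 m%:R - c * (\sum_i p i ^+ 2 - m%:R^-1).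
Proof.
move=> m0; have mp : 0 < m%:R :> R by rewrite ltr0n.
have mn0 : m%:R != 0 :> R by rewrite gt_eqF.
pose q : R := (Num.sqrt m%:R + 1) ^+ 2.
have q0 : 0 < q by rewrite exprn_gt0 // ltr_wpDl ?sqrtr_ge0.
exists (m%:R / q / ln 2); first by rewrite !divr_gt0 ?ln2_gt0.
move=> p p0 p1.
have p_le1 i : p i <= 1.
  by rewrite -p1 (bigD1 i) //= lerDl sumr_ge0.
rewrite shannon_image /log2.
rewrite [leRHS](_ : _ = (ln m%:R - m%:R / q * (\sum_i p i ^+ 2 - m%:R^-1)) / ln 2); last by ring.
rewrite ler_pM2r ?invr_gt0 ?ln2_gt0 // lerNl opprB.
have key i : (p i - m%:R^-1) + m%:R / q * (p i - m%:R^-1) ^+ 2 - p i * ln m%:R <= p i * ln (p i).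
  have [->|pn0] := eqVneq (p i) 0.
    rewrite !mul0r subr0 sub0r sqrrN.
    have -> : m%:R / q * m%:R^-1 ^+ 2 = m%:R^-1 * q^-1 :> R by field; rewrite mn0 gt_eqF.
    rewrite addrC subr_le0 ger_pMr ?invr_gt0 // invf_le1 // /q exprn_ege1 //.
    by rewrite lerDr sqrtr_ge0.
  have pp : 0 < p i by rewrite lt_def pn0 p0.
  pose y := p i * m%:R; have y0 : 0 < y by rewrite mulr_gt0.
  have := xlnx_sqrt (ltW y0); rewrite lnM ?posrE // => h.
  rewrite lerBlDr -mulrDr -(@ler_pM2r _ m%:R) //.
  rewrite [leRHS](_ : _ = y * (ln (p i) + ln m%:R)); last by rewrite /y; ring.
  apply: le_trans h.
  rewrite [leLHS](_ : _ = (y - 1) + (y - 1) ^+ 2 / q); last by rewrite /y; field; rewrite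
    mn0 gt_eqF.
  rewrite lerD2l ler_pdivrMr //.
  have -> : y - 1 = (Num.sqrt y - 1) * (Num.sqrt y + 1).
    by rewrite -{1}(sqr_sqrtr (ltW y0)); ring.
  rewrite exprMn ler_wpM2l ?sqr_ge0 // ler_pXn2r ?nnegrE ?addr_ge0 ?sqrtr_ge0 //.
  by rewrite lerD2r ler_wsqrtr // /y ger_pMl.
have : \sum_i ((p i - m%:R^-1) + m%:R / q * (p i - m%:R^-1) ^+ 2 - p i * ln m%:R)
      <= \sum_i p i * ln (p i) by apply: ler_sum.
apply: le_trans; rewrite sumrB big_split /= -mulr_suml p1 mul1r lerD2r sumrB p1.
rewrite sumr_const card_ord -[m%:R^-1 *+ m]mulr_natl mulfV // subrr add0r -mulr_sumr.
rewrite ler_pM2l ?divr_gt0 // le_eqVlt; apply/orP; left; apply/eqP.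
have -> : \sum_i (p i - m%:R^-1) ^+ 2 = \sum_i (p i ^+ 2 - p i * (2 / m%:R) + m%:R^-1 ^+ 2).
  by apply: eq_bigr => i _; field.
rewrite big_split /= sumrB -mulr_suml p1 sumr_const card_ord -[m%:R^-1 ^+ 2 *+ m]mulr_natl.
by field.
Qed.

End Entropy.

Section VonNeumann.
Variable R : realType.

(** A Gram matrix has at most as many non-zero eigenvalues as the smaller dimension of
    F; this makes the bound independent of the side of a bipartition that is chosen. *)
Lemma von_neumann_le (m n k : nat) (F : 'M[R[i]]_(m, n)) : F != 0 -> (0 < k)%N ->
  (m <= k)%N || (n <= k)%N ->
  von_neumann ((frob F)^-1 *: (F *m F^t*)) <= log2 k%:R.
Proof.
move=> F0 k0 mnk; rewrite /von_neumann; set sd := spectral_diag _.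
have sdR i : (complex.Re (sd 0 i))%:C%C = sd 0 i.
  by apply: RRe_real; rewrite ger0_real // spectral_ge0.
apply: shannon_le_log => //.
- by move=> i; rewrite -ler0c sdR spectral_ge0.
- apply: (@complexI R); rewrite rmorph_sum rmorph1 -(spectral_sum F0).
  by apply: eq_bigr => i _; apply: sdR.
have E : #|[pred i | complex.Re (sd 0 i) != 0]| = #|[pred i | sd 0 i != 0]|.
  by apply: eq_card => i; rewrite !inE -{2}sdR (inj_eq (@complexI R)).
case/orP: mnk => [mk|nk]; rewrite E.
  by rewrite (leq_trans (max_card _)) // card_ord.
by apply: leq_trans nk; apply: spectral_card.
Qed.

Lemma von_neumann_gap (m : nat) : (0 < m)%N -> exists2 c : R, 0 < c &
  forall n (F : 'M[R[i]]_(m, n)), F != 0 ->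
  let rho := (frob F)^-1 *: (F *m F^t*) in
  von_neumann rho <= log2 m%:R - c * complex.Re (frob (rho - (m%:R^-1)%:M)).
Proof.
move=> m0; have [c c0 H] := @shannon_gap R m m0; exists c => // n F F0 /=; set rho := _ *: _.
rewrite /von_neumann; set sd := spectral_diag _.
have sdR i : (complex.Re (sd 0 i))%:C%C = sd 0 i.
  by apply: RRe_real; rewrite ger0_real // spectral_ge0.
have p1 : \sum_i complex.Re (sd 0 i) = 1.
  apply: (@complexI R); rewrite rmorph_sum rmorph1 -(spectral_sum F0).
  by apply: eq_bigr => i _; apply: sdR.
have p0 i : 0 <= complex.Re (sd 0 i) by rewrite -ler0c sdR spectral_ge0.
apply: le_trans (H _ p0 p1) _; rewrite lerD2l lerN2 ler_pM2l //.
rewrite le_eqVlt; apply/orP; left; apply/eqP; apply: (@complexI R).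
rewrite RRe_real ?ger0_real ?frob_ge0 // rmorphB rmorph_sum fmorphV rmorph_nat.
have trrho : \tr rho = 1.
  by rewrite /rho linearZ /= -frob_trace mulVf // frob_eq0.
have -> : frob (rho - (m%:R^-1)%:M) = frob rho - m%:R^-1.
  rewrite !frob_trace linearB /= map_mxB gram_herm -/rho.
  have -> : (m%:R^-1)%:M ^t* = (m%:R^-1)%:M :> 'M[R[i]]_m.
    by rewrite tr_scalar_mx map_scalar_mx /= fmorphV rmorph_nat.
  rewrite mulmxBl !mulmxBr -scalar_mxM mul_scalar_mx mul_mx_scalar !linearB /=.
  rewrite [\tr (_ *: rho)]mxtraceZ trrho.
  rewrite mxtrace_scalar -[_ / _ *+ m]mulr_natl; field.
  by rewrite pnatr_eq0 -lt0n.
congr (_ - _); rewrite -(spectral_sqr F).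
apply: eq_bigr => i _. by rewrite -/rho -/sd rmorphXn -[in LHS]sdR.
Qed.

End VonNeumann.

(** * Flattenings and the lower functional *)

Section Flattening.
Variables (R : realType) (k d : nat).
Implicit Types (S : {set 'I_k}) (psi : 'rV[R[i]]_#|{: idx k d}|).

Lemma card_sub_idx S : #|{: sub_idx d S}| = (d ^ #|S|)%N.
Proof. by rewrite card_ffun card_ord card_sig; congr (_ ^ _)%N; apply: eq_card. Qed.

Lemma res_idx_inj S (m m' : idx k d) :
  res_idx S m = res_idx S m' -> res_idx (~: S) m = res_idx (~: S) m' -> m = m'.
Proof.
move=> /ffunP h /ffunP h'; apply/ffunP => j.
have [jS|jS] := boolP (j \in S); first by have := h (exist _ j jS); rewrite !ffunE.
by have jS' : j \in ~: S by [rewrite inE]; have := h' (exist _ j jS'); rewrite !ffunE.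
Qed.

Lemma res_idx_bij S :
  bijective (fun m : idx k d => (res_idx S m, res_idx (~: S) m)).
Proof.
apply: inj_card_bij => [m m' [] /res_idx_inj|]; first exact.
by rewrite card_prod !card_sub_idx -expnD cardsC !card_ffun !card_ord.
Qed.

Lemma flatteningE S psi (m : idx k d) :
  flattening S psi (enum_rank (res_idx S m)) (enum_rank (res_idx (~: S) m)) = coord psi m.
Proof.
rewrite mxE (big_pred1 m) // => m'; rewrite !enum_rankK /=.
apply/idP/eqP => [/andP[/eqP h /eqP h']|->]; last by rewrite !eqxx.
exact: res_idx_inj h h'.
Qed.

Lemma frob_flattening S psi : frob (flattening S psi) = sqnorm psi.
Proof.
rewrite /frob /sqnorm pair_big /=.
rewrite (reindex (fun m : idx k d => (enum_rank (res_idx S m), enum_rank (res_idx (~: S) m)))) /=.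
  rewrite [RHS](reindex (@enum_rank (idx k d))) /=; last exact/onW_bij/enum_rank_bij.
  by apply: eq_bigr => m _; rewrite flatteningE.
apply: onW_bij; apply: (@bij_comp _ _ _ (fun p => (enum_rank p.1, enum_rank p.2)) _ _
  (res_idx_bij S)).
exists (fun p => (enum_val p.1, enum_val p.2)) => [] [u v] /=; by rewrite ?enum_rankK ?enum_valK.
Qed.

Lemma flattening_eq0 S psi : (flattening S psi == 0) = (psi == 0).
Proof.
rewrite -frob_eq0 frob_flattening -[RHS]frob_eq0; congr (_ == 0).
by rewrite /frob big_ord1.
Qed.

Lemma density_frob S psi : density S psi =
  (frob (flattening S psi))^-1 *: (flattening S psi *m (flattening S psi)^t*).
Proof. by rewrite /density frob_flattening. Qed.

End Flattening.

Section Legs.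
Variables (R : realType) (d : nat).
Implicit Types (s : 'S_4) (psi : 'rV[R[i]]_#|{: idx 4 d}|).

Definition o0 : 'I_4 := Ordinal (isT : (0 < 4)%N).
Definition o1 : 'I_4 := Ordinal (isT : (1 < 4)%N).
Definition o2 : 'I_4 := Ordinal (isT : (2 < 4)%N).
Definition o3 : 'I_4 := Ordinal (isT : (3 < 4)%N).

(** The permutation s decides which leg carries which of the four indices. *)
Definition legs_idx s (q : 'I_d * 'I_d * 'I_d * 'I_d) : idx 4 d :=
  [ffun t => let u := (s^-1)%g t in
     if u == o0 then q.1.1.1 else if u == o1 then q.1.1.2 else
     if u == o2 then q.1.2 else q.2].

Lemma legs_idxE s q : [/\ legs_idx s q (s o0) = q.1.1.1, legs_idx s q (s o1) = q.1.1.2,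
  legs_idx s q (s o2) = q.1.2 & legs_idx s q (s o3) = q.2].
Proof. by rewrite /legs_idx !ffunE !permK. Qed.

Lemma legs_idx0 s q : legs_idx s q (s o0) = q.1.1.1. Proof. by case: (legs_idxE s q). Qed.
Lemma legs_idx1 s q : legs_idx s q (s o1) = q.1.1.2. Proof. by case: (legs_idxE s q). Qed.
Lemma legs_idx2 s q : legs_idx s q (s o2) = q.1.2. Proof. by case: (legs_idxE s q). Qed.
Lemma legs_idx3 s q : legs_idx s q (s o3) = q.2. Proof. by case: (legs_idxE s q). Qed.

Lemma ord4P (P : 'I_4 -> Prop) : P o0 -> P o1 -> P o2 -> P o3 -> forall t, P t.
Proof.
move=> P0 P1 P2 P3 [[|[|[|[|//]]]] lt].
- by have -> : Ordinal lt = o0 by apply: val_inj.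
- by have -> : Ordinal lt = o1 by apply: val_inj.
- by have -> : Ordinal lt = o2 by apply: val_inj.
- by have -> : Ordinal lt = o3 by apply: val_inj.
Qed.

Lemma legs_idx_bij s : bijective (legs_idx s).
Proof.
exists (fun m : idx 4 d => (m (s o0), m (s o1), m (s o2), m (s o3))) => [q|m].
  by have [-> -> -> ->] := legs_idxE s q; case: q => [[[]]].
apply/ffunP => t; rewrite -[t](permKV s); move: (s^-1%g t) => u {t}.
by elim/ord4P: u; have [? ? ? ?] := legs_idxE s (m (s o0), m (s o1), m (s o2), m (s o3)).
Qed.

Lemma prod_legs (A : comPzRingType) s (F : 'I_4 -> A) :
  \prod_t F t = F (s o0) * F (s o1) * F (s o2) * F (s o3).
Proof.
rewrite (reindex_inj (@perm_inj _ s)) !big_ord_recl big_ord0 /= mulr1 !mulrA.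
by congr (F (s _) * F (s _) * F (s _) * F (s _)); apply: val_inj.
Qed.

(** The flattening with rows indexed by the legs s 0 and s 1 and columns by s 2 and s 3,
    in the index format of Kronecker products. *)
Definition pair_mx s psi : 'M[R[i]]_(d * d) :=
  \matrix_(x, y) coord psi (legs_idx s ((mxtens_unindex x).1, (mxtens_unindex x).2,
                                        (mxtens_unindex y).1, (mxtens_unindex y).2)).

Lemma pair_mxE s psi a b c e :
  pair_mx s psi (mxtens_index (a, b)) (mxtens_index (c, e)) = coord psi (legs_idx s (a, b, c, e)).
Proof. by rewrite mxE !mxtens_indexK. Qed.

Lemma pair_mx_act s (A : 'I_4 -> 'M[R[i]]_d) psi :
  pair_mx s (tensor_act A psi) =
  (A (s o0) *t A (s o1)) *m pair_mx s psi *m (A (s o2) *t A (s o3))^T.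
Proof.
apply: matrix_tensP => a b c e; rewrite pair_mxE tens_mulmxE /coord mxE enum_rankK.
rewrite (reindex (legs_idx s)) /=; last exact/onW_bij/legs_idx_bij.
rewrite 3!pair_big /=; apply: eq_bigr => -[[[i j] k] l] _ /=.
rewrite pair_mxE (prod_legs s); have [-> -> -> ->] := legs_idxE s (a, b, c, e).
by have [-> -> -> ->] := legs_idxE s (i, j, k, l).
Qed.

Definition front s : {set 'I_4} := [set s o0; s o1].

Lemma mem_front s t : (s t \in front s) = (t == o0) || (t == o1).
Proof. by rewrite !inE !(inj_eq perm_inj). Qed.

(** The abstract flattening and the concrete one differ by a renaming of rows and
    columns. *)
Lemma flattening_pair s : exists f g,
  [/\ bijective f, bijective g & forall psi x y,
   flattening (front s) psi (f x) (g y) = pair_mx s psi x y].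
Proof.
pose f (x : 'I_(d * d)) := let p := mxtens_unindex x in
  enum_rank (res_idx (front s) (legs_idx s (p.1, p.2, p.1, p.1))).
pose g (x : 'I_(d * d)) := let p := mxtens_unindex x in
  enum_rank (res_idx (~: front s) (legs_idx s (p.1, p.1, p.1, p.2))).
have cF : #|front s| = 2%N by rewrite cards2 (inj_eq perm_inj).
have cF' : #|~: front s| = 2%N.
  by apply/eqP; rewrite -(eqn_add2l #|front s|) cardsC cF card_ord.
have rF (m m' : idx 4 d) : m (s o0) = m' (s o0) -> m (s o1) = m' (s o1) ->
    res_idx (front s) m = res_idx (front s) m' :> sub_idx d _.
  move=> h0 h1; apply/ffunP => -[j jF]; rewrite !ffunE /=.
  by move: jF; rewrite !inE => /orP[] /eqP ->.
have rF' (m m' : idx 4 d) : m (s o2) = m' (s o2) -> m (s o3) = m' (s o3) ->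
    res_idx (~: front s) m = res_idx (~: front s) m' :> sub_idx d _.
  move=> h0 h1; apply/ffunP => -[j jF]; rewrite !ffunE /=; move: jF.
  rewrite -[j](permKV s); move: (s^-1%g j) => u; rewrite inE mem_front.
  by elim/ord4P: u.
have rFE (m m' : idx 4 d) : res_idx (front s) m = res_idx (front s) m' :> sub_idx d _ ->
    m (s o0) = m' (s o0) /\ m (s o1) = m' (s o1).
  move/ffunP => h; have i0 : s o0 \in front s by rewrite mem_front.
  have i1 : s o1 \in front s by rewrite mem_front.
  by split; [have := h (exist _ (s o0) i0) | have := h (exist _ (s o1) i1)]; rewrite !ffunE.
have rFE' (m m' : idx 4 d) : res_idx (~: front s) m = res_idx (~: front s) m' :> sub_idx d _ ->
    m (s o2) = m' (s o2) /\ m (s o3) = m' (s o3).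
  move/ffunP => h; have i0 : s o2 \in ~: front s by rewrite inE mem_front.
  have i1 : s o3 \in ~: front s by rewrite inE mem_front.
  by split; [have := h (exist _ (s o2) i0) | have := h (exist _ (s o3) i1)]; rewrite !ffunE.
exists f, g; split.
- apply: inj_card_bij; last by rewrite card_ord card_ord card_sub_idx cF -mulnn.
  move=> x y /enum_rank_inj /rFE; rewrite !legs_idx0 !legs_idx1 /= => -[h h'];
  by apply: (can_inj (@mxtens_unindexK d d)); rewrite /mxtens_unindex h h'.
- apply: inj_card_bij; last by rewrite card_ord card_ord card_sub_idx cF' -mulnn.
  move=> x y /enum_rank_inj /rFE'; rewrite !legs_idx2 !legs_idx3 /= => -[h h'];
  by apply: (can_inj (@mxtens_unindexK d d)); rewrite /mxtens_unindex h h'.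
move=> psi x y; rewrite [RHS]mxE -(flatteningE (front s)) /f /g.
congr (flattening _ _ (enum_rank _) (enum_rank _)).
  by apply: rF; rewrite ?legs_idx0 ?legs_idx1.
by apply: rF'; rewrite ?legs_idx2 ?legs_idx3.
Qed.

End Legs.

Section LowerGap.
Variables (R : realType) (d : nat).
Hypothesis d0 : (0 < d)%N.
Local Notation C := R[i].

Lemma realign_ratio_scale (t : C) (M : 'M[C]_(d * d)) : t != 0 ->
  realign_ratio (t *: M) = realign_ratio M.
Proof.
move=> t0; rewrite /realign_ratio realignZ !detZ invfM mulrACA divff ?mul1r //.
by rewrite expf_neq0.
Qed.

(** The scalar t normalizes M so that [unitary_gap] applies; after normalization the
    distance of M M^* to the identity is that of the reduced density matrix to the
    maximally mixed one, up to the factor d^2. *)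
Lemma purity_gap (r r' : C) : r' != r^*%R -> exists2 e : R, 0 < e & forall M : 'M[C]_(d * d),
  M \in unitmx -> realign_ratio M = r -> realign_ratio (invmx M)^T = r' ->
  e <= complex.Re (frob ((frob M)^-1 *: (M *m M^t*) - ((d * d)%:R^-1)%:M)).
Proof.
move=> rr'; have [e0 e0_gt0 H] := unitary_gap d0 rr'.
have N0 : (0 < (d * d)%:R :> C) by rewrite ltr0n muln_gt0 d0.
pose e := (e0 / (d * d)%:R) ^+ 2; have e_gt0 : 0 < e by rewrite exprn_gt0 // divr_gt0.
have eR : (complex.Re e)%:C%C = e by apply: RRe_real; rewrite gtr0_real.
exists (complex.Re e); first by rewrite -ltcR eR.
move=> M uM rM rM'; have M0 : M != 0 by rewrite (unitmx_neq0 _ uM) // muln_gt0 d0.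
have f0 : 0 < frob M by rewrite lt_def frob_eq0 M0 frob_ge0.
pose t := sqrtC ((d * d)%:R / frob M).
have t2 : t ^+ 2 = (d * d)%:R / frob M by rewrite sqrtCK.
have t0 : t != 0 by rewrite sqrtC_eq0 gt_eqF // divr_gt0.
have tp : 0 <= t by rewrite sqrtC_ge0 divr_ge0 // ltW.
have [|||| i [j ij]] := H (t *: M).
- by rewrite unitmxZ // unitfE.
- by rewrite frobZ ger0_norm // t2 divfK // gt_eqF.
- by rewrite realign_ratio_scale.
- have -> : (invmx (t *: M))^T = t^-1 *: (invmx M)^T.
    by rewrite invmx_scale //; apply/matrixP => k l; rewrite !mxE.
  by rewrite realign_ratio_scale ?invr_eq0.
set rho := _ *: _; rewrite -lecR eR RRe_real ?ger0_real ?frob_ge0 //.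
apply: le_trans (le_frob _ i j); rewrite ler_pXn2r ?nnegrE ?normr_ge0 ?divr_ge0 ?(ltW N0)
  ?(ltW e0_gt0) //.
rewrite ler_pdivrMr // -[X in _ * X]ger0_norm ?(ltW N0) // -normrM.
apply: le_trans ij _; rewrite le_eqVlt; apply/orP; left; apply/eqP; congr `|_|.
have -> : (t *: M) *m (t *: M)^t* = (d * d)%:R *: rho.
  rewrite /rho linearZ /= map_mxZ -scalemxAl -scalemxAr !scalerA; congr (_ *: _).
  by rewrite /= (geC0_conj tp) -expr2 t2.
rewrite mulrC !mxE mulrBr; congr (_ - _).
by case: (i == j); rewrite ?mulr1n ?mulr0n ?mulr0 // divff // gt_eqF.
Qed.

Lemma front_purity (s : 'S_4) (psi : 'rV[C]_#|{: idx 4 d}|) :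
  let F := flattening (front s) psi in let M := pair_mx s psi in
  frob ((frob F)^-1 *: (F *m F^t*) - (#|{: sub_idx d (front s)}|%:R^-1)%:M) =
  frob ((frob M)^-1 *: (M *m M^t*) - ((d * d)%:R^-1)%:M).
Proof.
move=> F M; have [f [g [bf bg FM]]] := flattening_pair R d s.
have E : frob F = frob M.
  rewrite (frob_reindex _ bf bg); congr frob; apply/matrixP => i j; rewrite [LHS]mxE.
  exact: FM.
rewrite (frob_reindex _ bf bf); congr frob; apply/matrixP => i j.
have card : #|{: sub_idx d (front s)}| = (d * d)%N.
  by rewrite card_sub_idx cards2 (inj_eq perm_inj) mulnn.
rewrite [LHS]mxE [LHS]mxE [RHS]mxE; congr (_ + _); last first.
  by rewrite !mxE (inj_eq (bij_inj bf)) card.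
rewrite [LHS]mxE [RHS]mxE E; congr (_ * _); rewrite [LHS]mxE [RHS]mxE (reindex g); last
  exact: onW_bij.
apply: eq_bigr => l _; congr (_ * _); first exact: FM.
by rewrite [LHS]mxE [RHS]mxE; congr (_^*%R); rewrite [LHS]mxE [RHS]mxE; exact: FM.
Qed.

Lemma tensor_act_eq0 (A : 'I_4 -> 'M[C]_d) (psi : 'rV[C]_#|{: idx 4 d}|) :
  (forall j, A j \in unitmx) -> psi != 0 -> tensor_act A psi != 0.
Proof.
move=> uA; apply: contraNneq => Apsi; have d0' : d != 0%N by rewrite -lt0n.
have M0 : pair_mx 1 (tensor_act A psi) = 0.
  by apply/matrixP => i j; rewrite mxE Apsi /coord !mxE.
have u i j : (A i *t A j) \in unitmx by rewrite tensmx_unit.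
have {}M0 : pair_mx 1 psi = 0.
  move: M0; rewrite pair_mx_act => /(congr1 (mulmx (invmx (A ((1 : 'S_4)%g o0) *t A ((1 :
    'S_4)%g o1))))).
  rewrite mulmx0 -mulmxA mulKmx // => /(congr1 (mulmx^~ (invmx (A ((1 : 'S_4)%g o2) *t A
    ((1 : 'S_4)%g o3))^T))).
  by rewrite mulmxK ?mul0mx // unitmx_tr.
apply/eqP/rowP => m; rewrite mxE -[m]enum_valK.
have [f fK Kf] := legs_idx_bij d 1; rewrite -[enum_val m]Kf.
move: (f _) => [[[a b] c] e].
have /matrixP/(_ (mxtens_index (a, b)) (mxtens_index (c, e))) := M0.
by rewrite pair_mxE mxE.
Qed.

Lemma pair_mx_unit_neq0 (s : 'S_4) (psi : 'rV[C]_#|{: idx 4 d}|) :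
  pair_mx s psi \in unitmx -> psi != 0.
Proof.
move=> uM; apply: contra_neq (unitmx_neq0 _ uM) => [->|]; last by rewrite muln_gt0 d0.
by apply/matrixP => i j; rewrite !mxE /coord mxE.
Qed.

(** The constant e depends on psi only through the two invariants, which are the same
    for all tensor_act A psi; hence the bound is uniform in A. *)
Lemma H_bip_gap (b : bipartition 4) (s : 'S_4) (psi : 'rV[C]_#|{: idx 4 d}|) :
  side b = front s -> pair_mx s psi \in unitmx ->
  realign_ratio (invmx (pair_mx s psi))^T != (realign_ratio (pair_mx s psi))^*%R ->
  exists2 e : R, 0 < e & forall A, (forall j, A j \in unitmx) ->
    H_bip b (tensor_act A psi) <= log2 (d ^ 2)%:R - e.
Proof.
move=> sb uM rr'; have [e e0 He] := purity_gap rr'.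
have card : #|{: sub_idx d (front s)}| = (d ^ 2)%N.
  by rewrite card_sub_idx cards2 (inj_eq perm_inj).
have [|c c0 Hc] := @von_neumann_gap R #|{: sub_idx d (front s)}|.
  by rewrite card expn_gt0 d0.
exists (c * e) => [|A uA]; first by rewrite mulr_gt0.
have d0' : d != 0%N by rewrite -lt0n.
have psi0 := pair_mx_unit_neq0 uM.
rewrite /H_bip density_frob sb.
apply: le_trans (Hc _ _ _) _; first by rewrite flattening_eq0 tensor_act_eq0.
rewrite -card lerD2l lerN2 ler_pM2l // front_purity pair_mx_act.
apply: He; rewrite ?realign_ratio_act ?realign_ratio_inv_act //.
by rewrite !unitmx_mul uM unitmx_tr !tensmx_unit.
Qed.

Lemma H_bip_le (b : bipartition 4) (S : {set 'I_4}) (psi : 'rV[C]_#|{: idx 4 d}|) :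
  psi != 0 -> side b = S -> (#|S| == 1%N) || (#|~: S| == 1%N) -> H_bip b psi <= log2 d%:R.
Proof.
move=> psi0 sb S1; rewrite /H_bip density_frob sb; apply: von_neumann_le => //.
  by rewrite flattening_eq0.
by rewrite !card_sub_idx; case/orP: S1 => /eqP->; rewrite expn1 leqnn ?orbT.
Qed.

End LowerGap.

(** * The generic set *)

Section PolyFun.
Local Open Scope classical_set_scope.
Variables (R : realType) (n : nat).
Local Notation C := (R[i])%C.
Local Notation V := 'rV[C^o]_n.

(** What is needed of the polynomial functions in the real and imaginary parts of the
    coordinates: continuity, and polynomiality in t along each real line. The line
    condition survives complex conjugation because t is real. *)
Definition polyfun (F : V -> C^o) : Prop := continuous F /\
  forall p q : V, exists P : {poly C}, forall t : R, F (p + (t%:C)%C *: q) = P.[(t%:C)%C].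

Lemma polyfun_ext F G : F =1 G -> polyfun F -> polyfun G.
Proof. by move=> /funext ->. Qed.

Lemma polyfun_cst c : polyfun (fun=> c).
Proof.
by split=> [x|p q]; [exact: cst_continuous|exists c%:P => t; rewrite hornerC].
Qed.

Lemma polyfun_coord i : polyfun (fun v => v 0 i).
Proof.
split=> [x|p q]; first exact: coord_continuous.
by exists ((p 0 i)%:P + (q 0 i)%:P * 'X) => t; rewrite !mxE !hornerE mulrC.
Qed.

Lemma polyfunD F G : polyfun F -> polyfun G -> polyfun (fun v => F v + G v).
Proof.
move=> [cF lF] [cG lG]; split=> [x|p q]; first exact: (cvgD (cF x) (cG x)).
by have [[P HP] [Q HQ]] := (lF p q, lG p q); exists (P + Q) => t; rewrite hornerD HP HQ.
Qed.

Lemma polyfunM F G : polyfun F -> polyfun G -> polyfun (fun v => F v * G v).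
Proof.
move=> [cF lF] [cG lG]; split=> [x|p q]; first exact: (cvgM (cF x) (cG x)).
by have [[P HP] [Q HQ]] := (lF p q, lG p q); exists (P * Q) => t; rewrite hornerM HP HQ.
Qed.

Lemma polyfun_conj F : polyfun F -> polyfun (fun v => (F v)^*).
Proof.
move=> [cF lF]; split=> [x|p q].
  have cC : continuous (Num.conj : C^o -> C^o).
    move=> z; apply/(@cvgrPdist_lt _ C^o _ _ (nbhs_filter (z : C^o))) => e e0.
    have := @cvgr_dist_lt _ C^o _ _ (nbhs_filter (z : C^o)) id z cvg_id e e0.
    by apply: filterS => y; rewrite -rmorphB norm_conjC.
  exact: (@cvg_comp _ _ _ _ _ _ _ _ (cF x) (cC (F x))).
have [P HP] := lF p q; exists (map_poly Num.conj P) => t; rewrite HP.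
rewrite -horner_map /= conj_Creal //.
by apply/complex_realP; exists t.
Qed.

Lemma polyfun_sum (I : Type) (r : seq I) (P : pred I) (F : I -> V -> C^o) :
  (forall i, polyfun (F i)) -> polyfun (fun v => \sum_(i <- r | P i) F i v).
Proof.
move=> pF; elim: r => [|i r IH].
  by apply: polyfun_ext (polyfun_cst 0) => v; rewrite big_nil.
case Pi: (P i); last by apply: polyfun_ext IH => v; rewrite big_cons Pi.
by apply: polyfun_ext (polyfunD (pF i) IH) => v; rewrite big_cons Pi.
Qed.

Lemma polyfun_prod (I : Type) (r : seq I) (P : pred I) (F : I -> V -> C^o) :
  (forall i, polyfun (F i)) -> polyfun (fun v => \prod_(i <- r | P i) F i v).
Proof.
move=> pF; elim: r => [|i r IH].
  by apply: polyfun_ext (polyfun_cst 1) => v; rewrite big_nil.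
case Pi: (P i); last by apply: polyfun_ext IH => v; rewrite big_cons Pi.
by apply: polyfun_ext (polyfunM (pF i) IH) => v; rewrite big_cons Pi.
Qed.

Lemma polyfun_exp F m : polyfun F -> polyfun (fun v => F v ^+ m).
Proof.
move=> pF; have := @polyfun_prod _ (iota 0 m) xpredT (fun=> F) (fun=> pF).
by apply: polyfun_ext => v; rewrite big_const_seq count_predT size_iota -Monoid.iteropE.
Qed.

Lemma polyfun_det m (F : V -> 'M[C]_m) :
  (forall i j, polyfun (fun v => F v i j)) -> polyfun (fun v => \det (F v)).
Proof.
move=> pF; apply: polyfun_sum => s; apply: polyfunM; first exact: polyfun_cst.
exact: polyfun_prod.
Qed.

Lemma polyfun_adj m (F : V -> 'M[C]_m) :
  (forall i j, polyfun (fun v => F v i j)) -> forall i j, polyfun (fun v => (\adj (F v)) i j).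
Proof.
move=> pF i j; have : polyfun (fun v => cofactor (F v) j i).
  apply: polyfunM; first exact: polyfun_cst.
  by apply: polyfun_det => k l; apply: polyfun_ext (pF (lift j k) (lift i l)) => v; rewrite !mxE.
by apply: polyfun_ext => v; rewrite mxE.
Qed.

Lemma polyfun_open F : polyfun F -> open [set v | F v != 0].
Proof.
move=> [cF _]; rewrite openE => v /= Fv.
exact: (cvgr_neq0 _ (cF v) Fv).
Qed.

(** On the line from p to a point where F does not vanish, F is a non-zero polynomial in
    t, so that it has a non-root among any infinite sequence of parameters converging to
    0. *)
Lemma polyfun_dense F : polyfun F -> (exists v, F v != 0) -> dense [set v | F v != 0].
Proof.
move=> [_ lF] [v Fv] O [p Op] oO; have [P HP] := lF p (v - p).
have P0 : P != 0.
  apply: contraNneq Fv => P0; have := HP 1; rewrite P0 horner0 => <-.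
  by rewrite rmorph1 scale1r addrC subrK.
have /nbhs_normP[e /= e0 He] : nbhs p O by apply: open_nbhs_nbhs.
have eR : (complex.Re e)%:C%C = e by apply: RRe_real; rewrite gtr0_real.
pose w : V := v - p.
(* These parameters are distinct and keep the points in the ball of radius e around p. *)
pose t (k : nat) : C := (e / (`|w| + 1)) / k.+2%:R.
have w1 : 0 < `|w| + 1 by rewrite ltr_wpDl.
have t_gt0 k : 0 < t k by rewrite !divr_gt0 // ltr0n.
have tR k : (complex.Re (t k))%:C%C = t k by apply: RRe_real; rewrite gtr0_real.
have tO k : O (p + t k *: w).
  apply: He; rewrite /ball_ /= opprD addrA subrr add0r normrN normrZ gtr0_norm //.
  have k0 : 0 < k.+2%:R :> C by rewrite ltr0n.
  have -> : t k * `|w| = e * (`|w| / ((`|w| + 1) * k.+2%:R)).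
    by rewrite /t; move: (k.+2%:R : C) k0 => K k0; field; rewrite !gt_eqF.
  rewrite gtr_pMr // ltr_pdivrMr ?mulr_gt0 // mul1r.
  by rewrite (@lt_le_trans _ _ (`|w| + 1)) ?ltrDl // ler_pMr // ler1n.
have [k kP] : exists k, ~~ root P (t k).
  apply: contrapT => Nk; have rt k : root P (t k).
    by apply: contrapT => /negP h; apply: Nk; exists k.
  have := @max_poly_roots _ P [seq t k | k <- iota 0 (size P)] P0.
  rewrite size_map size_iota ltnn => h; suff : false by [].
  apply: h; first by apply/allP => _ /mapP[k _ ->]; exact: rt.
  rewrite map_inj_uniq ?iota_uniq // => i j; rewrite /t => /(mulfI _).
  have e1 : e / (`|w| + 1) != 0 by rewrite gt_eqF // divr_gt0.
  by move=> /(_ e1)/invr_inj/eqP; rewrite eqr_nat => /eqP[].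
exists (p + t k *: w); split; first exact: tO.
by rewrite /= -(tR k) HP tR.
Qed.

End PolyFun.

Section GenericSet.
Local Open Scope classical_set_scope.
Variables (R : realType) (d : nat).
Hypothesis hd : (1 < d)%N.
Local Notation C := (R[i])%C.
Local Notation V := 'rV[C^o]_#|{: idx 4 d}|.

(** The identity between the two invariants, cleared of denominators. *)
Definition obstruction (M : 'M[C]_(d * d)) : C :=
  \det M * (\det (realign (\adj M)^T) * (\det M)^*
            - (\det (realign M))^* * \det M ^+ (d * d).-1).

Lemma obstruction_neq0P (M : 'M[C]_(d * d)) : reflect
  (M \in unitmx /\ realign_ratio (invmx M)^T != (realign_ratio M)^*) (obstruction M != 0).
Proof.
rewrite /obstruction mulf_eq0 negb_or unitmxE unitfE.
have N0 : (0 < d * d)%N by rewrite muln_gt0 ltnW.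
have [dM|dM] := eqVneq (\det M) 0; first by constructor=> -[].
have uM : M \in unitmx by rewrite unitmxE unitfE.
have E : realign_ratio (invmx M)^T = \det (realign (\adj M)^T) / \det M ^+ (d * d).-1.
  have -> : \adj M = \det M *: invmx M by rewrite /invmx uM scalerA divff // scale1r.
  rewrite linearZ /= realignZ detZ /realign_ratio det_tr det_inv invrK.
  have -> : \det M ^+ (d * d) = \det M * \det M ^+ (d * d).-1 by rewrite -exprS prednK.
  by move: (\det M ^+ _.-1) (expf_neq0 (d * d).-1 dM) => D D0; field.
have -> : (\det (realign (\adj M)^T) * (\det M)^*
            - (\det (realign M))^* * \det M ^+ (d * d).-1 != 0)
    = (realign_ratio (invmx M)^T != (realign_ratio M)^*).
  rewrite E /realign_ratio rmorphM fmorphV subr_eq0 eqr_div //= ?conjC_eq0 //.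
  exact: expf_neq0.
by apply: (iffP idP) => [|[_]].
Qed.

Lemma obstruction_polyfun (s : 'S_4) : polyfun (fun psi : V => obstruction (pair_mx s psi)).
Proof.
have pM i j : polyfun (fun psi : V => pair_mx s psi i j).
  pose m := legs_idx s ((mxtens_unindex i).1, (mxtens_unindex i).2,
                        (mxtens_unindex j).1, (mxtens_unindex j).2).
  by apply: polyfun_ext (@polyfun_coord R _ (enum_rank m)) => psi; rewrite [RHS]mxE.
have pd : polyfun (fun psi : V => \det (pair_mx s psi)) by exact: polyfun_det.
apply: polyfunM => //; apply: polyfunD.
  apply: polyfunM; last exact: polyfun_conj.
  apply: polyfun_det => i j; apply: polyfun_ext (polyfun_adj pM _ _) => psi.
  by rewrite [RHS]mxE [RHS]mxE.
have -> : (fun psi : V => - ((\det (realign (pair_mx s psi)))^* * \det (pair_mx s psi) ^+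
  (d * d).-1))
   = (fun psi : V => (-1) * ((\det (realign (pair_mx s psi)))^* * \det (pair_mx s psi) ^+
     (d * d).-1)).
  by apply/funext => psi; rewrite mulN1r.
apply: polyfunM; first exact: polyfun_cst.
apply: polyfunM; last exact: polyfun_exp.
apply: polyfun_conj; apply: polyfun_det => i j; apply: polyfun_ext (pM _ _) => psi.
by rewrite [RHS]mxE.
Qed.

Lemma obstruction_witness (s : 'S_4) : exists psi : V, obstruction (pair_mx s psi) != 0.
Proof.
have [f fK Kf] := legs_idx_bij d s.
pose psi : V := \row_m let q := f (enum_val m) in
  witness C d (mxtens_index (q.1.1.1, q.1.1.2)) (mxtens_index (q.1.2, q.2)).
exists psi; have -> : pair_mx s psi = witness C d.
  by apply: matrix_tensP => a b c e; rewrite pair_mxE /coord mxE enum_rankK fK.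
apply/obstruction_neq0P; split; first exact: witness_unit.
by rewrite realign_ratio_witness // conjC0 realign_ratio_inv_witness.
Qed.

(** All orderings of the legs are taken, so that every balanced bipartition is
    covered. *)
Definition generic_set : set V := [set psi | forall s : 'S_4, obstruction (pair_mx s psi) != 0].

Lemma generic_set_open_dense : open generic_set /\ dense generic_set.
Proof.
pose U (l : seq 'S_4) : set V := [set psi | all (fun s => obstruction (pair_mx s psi) != 0) l].
have -> : generic_set = U (enum 'S_4).
  apply/seteqP; split=> [psi H|psi /allP H s]; last by apply: H; rewrite mem_enum.
  by apply/allP => s _; apply: H.
elim: (enum 'S_4) => [|s l [oU dU]].
  have -> : U [::] = [set: V] by apply/seteqP.
  by split; [exact: openT | move=> O [p Op] _; exists p].
have -> : U (s :: l) = U l `&` [set psi | obstruction (pair_mx s psi) != 0].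
  by apply/seteqP; split=> [psi /= /andP[? ?]|psi /= [? ?]]; [split|apply/andP].
have os := polyfun_open (obstruction_polyfun s).
split; first exact: openI.
move=> O O0 oO; rewrite classical_sets.setIA; apply: (polyfun_dense (obstruction_polyfun s)).
- exact: obstruction_witness.
- exact: dU.
- exact: openI.
Qed.

End GenericSet.

(** * Specht modules and isotypic components *)

Section Isotypic.
Variables (F : fieldType) (n N : nat).
Variable rG : mx_representation F [set: 'S_n]%G N.
Variable lam : seq nat.
Local Notation reg := (regular_repr F [set: 'S_n]%G).
Local Notation Sp := (specht_mod F n lam).
Local Notation ys := (young_symmetrizer F n lam).

Lemma isotypic_ub (U : 'M[F]_N) (modU : mxmodule rG U) :
  mx_rsim (submod_repr modU) (specht_repr F n lam) -> (U <= isotypic rG lam)%MS.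
Proof.
move=> sim; apply: ((sum_familyP _ (isotypic rG lam)).1 (submx_refl _)).
by exists modU.
Qed.

(** The image of the Specht module under an equivariant map that is injective on it is
    one of the submodules whose sum is the isotypic component. *)
Lemma isotypic_hom (Phi : 'M[F]_(#|[set: 'S_n]%SET|, N)) :
  (forall s, reg s *m Phi = Phi *m rG s) ->
  (forall x : 'rV_#|[set: 'S_n]%SET|, (x <= Sp)%MS -> x *m Phi = 0 -> x = 0) ->
  (Sp *m Phi <= isotypic rG lam)%MS.
Proof.
move=> eqv inj; set modSp := cyclic_mx_module reg ys.
pose U := <<Sp *m Phi>>%MS; have UE : (U :=: Sp *m Phi)%MS := genmxE _.
have modU : mxmodule rG U.
  apply/mxmoduleP => s sG; rewrite (eqmxMr (rG s) UE) UE -mulmxA -eqv mulmxA submxMr //.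
  exact: mxmoduleP modSp s sG.
suff h : (U <= isotypic rG lam)%MS by rewrite -UE.
apply: (@isotypic_ub _ modU); apply: mx_rsim_sym.
have vU : (@val_submod _ _ Sp _ 1%:M *m Phi <= U)%MS by rewrite UE submxMr // val_submod1.
pose B := in_submod U (@val_submod _ _ Sp _ 1%:M *m Phi).
have freeB : row_free B.
  apply: inj_row_free => v; rewrite /B in_submodE mulmxA -in_submodE.
  move/(congr1 (@val_submod _ _ U _)); rewrite linear0 in_submodK; last first.
    by rewrite mulmxA -mulmxA mulmx_sub // UE.
  rewrite mulmxA -val_submodE => /inj h.
  by apply/eqP; rewrite -(val_submod_eq0 v) h ?val_submodP.
apply: (MxReprSim _ freeB).
  apply/eqP; rewrite eqn_leq -{1}(eqP freeB) rank_leq_col /=.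
  by rewrite UE mxrankM_maxl.
move=> s sG; rewrite /B -in_submodJ //.
transitivity (in_submod U (specht_repr F n lam s *m (@val_submod _ _ Sp _ 1%:M *m Phi))).
  by rewrite in_submodE [RHS]in_submodE mulmxA.
have key : specht_repr F n lam s *m @val_submod _ _ Sp _ 1%:M = @val_submod _ _ Sp _ 1%:M *m reg s.
  by rewrite -[RHS](val_submodJ modSp) // mul1mx [RHS]val_submodE.
congr (in_submod _ _); move: (@val_submod _ _ _ _ _) key => vS key.
by rewrite mulmxA key -(mulmxA vS (reg s)) eqv mulmxA.
Qed.

(** The elements mapped into the submodule W form a submodule, so that it is enough to
    test the generator. *)
Lemma cyclic_hom_sub (u : 'rV_#|[set: 'S_n]%SET|) (Phi : 'M[F]_(#|[set: 'S_n]%SET|, N)) (W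
  : 'M[F]_N) :
  (forall s, reg s *m Phi = Phi *m rG s) -> mxmodule rG W ->
  (u *m Phi <= W)%MS -> (cyclic_mx reg u *m Phi <= W)%MS.
Proof.
move=> eqv modW uW; pose K := kermx (Phi *m cokermx W).
have KE m (x : 'M_(m, _)) : (x <= K)%MS = (x *m Phi <= W)%MS.
  by rewrite (sameP sub_kermxP eqP) mulmxA submxE.
rewrite -KE; apply: cyclic_mx_sub; last by rewrite KE.
apply/mxmoduleP => s sG; rewrite KE -mulmxA eqv mulmxA.
by apply: (mxmodule_trans modW) => //; rewrite -KE.
Qed.

Lemma col_stabM q q' : q \in col_stab n lam -> q' \in col_stab n lam ->
  (q * q')%g \in col_stab n lam.
Proof.
rewrite !inE => /forallP h /forallP h'; apply/forallP => i.
by rewrite permM (eqP (h' _)) h.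
Qed.

Lemma col_stabV q : q \in col_stab n lam -> (q^-1)%g \in col_stab n lam.
Proof.
by rewrite !inE => /forallP h; apply/forallP => i; rewrite -(eqP (h _)) permKV.
Qed.

Lemma row_stabM q q' : q \in row_stab n lam -> q' \in row_stab n lam ->
  (q * q')%g \in row_stab n lam.
Proof.
rewrite !inE => /forallP h /forallP h'; apply/forallP => i.
by rewrite permM (eqP (h' _)) h.
Qed.

Lemma row_stabV q : q \in row_stab n lam -> (q^-1)%g \in row_stab n lam.
Proof.
by rewrite !inE => /forallP h; apply/forallP => i; rewrite -(eqP (h _)) permKV.
Qed.

Lemma stab1 : (1%g \in row_stab n lam) * (1%g \in col_stab n lam).
Proof. by rewrite !inE; split; apply/forallP => i; rewrite perm1. Qed.

Lemma delta_reg g s : delta_mx 0 (gring_index [set: 'S_n]%G g) *m reg s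
  = delta_mx 0 (gring_index [set: 'S_n]%G (g * s)%g) :> 'rV[F]__.
Proof. by rewrite -rowE rowK gring_indexK ?inE. Qed.

(** The Young symmetrizer has the column antisymmetrizer as its right factor. *)
Lemma young_col q : q \in col_stab n lam -> ys *m reg q = (-1) ^+ (q : bool) *: ys.
Proof.
move=> qC; rewrite /young_symmetrizer mulmx_suml scaler_sumr; apply: eq_bigr => p _.
rewrite mulmx_suml scaler_sumr.
rewrite [RHS](reindex_inj (mulIg q)) /=; apply: eq_big => [r|r rC].
  by apply/idP/idP => [rC|rC]; [exact: col_stabM|rewrite -(mulgK q r) col_stabM ?col_stabV].
by rewrite -scalemxAl delta_reg mulgA scalerA odd_permM signr_addb mulrCA -signr_addb addbb mulr1.
Qed.

Hypothesis char0 : forall m, (0 < m)%N -> m%:R != 0 :> F.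

(** By [young_col], the image v of the Young symmetrizer in a copy of the Specht module
    is multiplied by #|col_stab| when the column antisymmetrizer acts; but that operator
    is zero, so v = 0 and the copy is trivial. *)
Lemma isotypic_eq0 :
  \sum_(q in col_stab n lam) (-1) ^+ (q : bool) *: rG q = 0 -> isotypic rG lam = 0.
Proof.
move=> kill; apply/eqP; rewrite -submx0; apply/sum_familyP => U [modU].
move=> /mx_rsim_sym[B rk freeB eqv].
have ysSp : (ys <= Sp)%MS := cyclic_mx_id _ _.
pose v : 'rV_N := val_submod (in_submod Sp ys *m B).
have vq q : q \in col_stab n lam -> v *m rG q = (-1) ^+ (q : bool) *: v.
  move=> qC; rewrite /v -(val_submodJ modU) ?inE // -mulmxA -eqv ?inE // mulmxA.
  by rewrite -in_submodJ // young_col // !linearZ /= -scalemxAl linearZ.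
have v0 : v = 0.
  have : v *m \sum_(q in col_stab n lam) (-1) ^+ (q : bool) *: rG q = 0 by rewrite kill mulmx0.
  rewrite mulmx_sumr (eq_bigr (fun=> v)) => [|q qC]; last first.
    by rewrite -scalemxAr vq // scalerA -signr_addb addbb scale1r.
  rewrite sumr_const -scaler_nat => /eqP; rewrite scaler_eq0 (negPf (char0 _)).
    by move/eqP.
  by apply/card_gt0P; exists 1%g; rewrite stab1.
have ys0 : ys = 0.
  move/eqP: v0; rewrite /v val_submod_eq0 => /eqP h.
  have := row_free_inj freeB; move/(_ _ (in_submod Sp ys) 0); rewrite h mul0mx => /(_ erefl) E.
  by rewrite -(in_submodK ysSp) E linear0.
have rU : \rank U = 0%N.
  by rewrite -rk /specht_mod ys0; apply/eqP; rewrite mxrank_eq0 cyclic_mx_eq0.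
by apply/eqP; rewrite submx0 -mxrank_eq0 rU.
Qed.

End Isotypic.

(** * Words and permutations of their letters *)

Section Words.
Variables (R : realType) (k d n : nat).
Local Notation C := R[i].
Local Notation word := (pow_idx k d n).
Local Notation NW := #|{: word}|.
Local Notation G := [set: 'S_n]%G.
Local Notation gi := (gring_index [set: 'S_n]%G).
Local Notation reg := (regular_repr C [set: 'S_n]%G).
Implicit Types (S T : {set 'I_k}) (s u p q : 'S_n) (w v : word).

Definition basis_word w : 'rV[C]_NW := delta_mx 0 (enum_rank w).

Lemma basis_word_mx (A B : 'M[C]_NW) :
  (forall w, basis_word w *m A = basis_word w *m B) -> A = B.
Proof.
by move=> AB; apply/row_matrixP => m; rewrite !rowE -[m]enum_valK; exact: AB.
Qed.

Lemma basis_word_permute w S s :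
  basis_word w *m permute_mx R d S s = basis_word (permute_idx S s w).
Proof.
rewrite /basis_word -rowE; apply/rowP => m; rewrite !mxE enum_rankK eqxx /=.
by rewrite -{2}[m]enum_valK (inj_eq enum_rank_inj).
Qed.

Lemma permute_idxM S s u w :
  permute_idx S (s * u)%g w = permute_idx S u (permute_idx S s w).
Proof.
apply/ffunP => t; apply/ffunP => j; rewrite !ffunE; case: ifP => // jS.
by rewrite ?ffunE ?jS invMg permM.
Qed.

Lemma permute_idx1 S w : permute_idx S 1%g w = w.
Proof. by apply/ffunP => t; apply/ffunP => j; rewrite !ffunE invg1 perm1 if_same. Qed.

Lemma permute_idx_inj S s : injective (permute_idx S s : word -> word).
Proof.
by move=> w v /(congr1 (permute_idx S s^-1%g)); rewrite -!permute_idxM mulgV !permute_idx1.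
Qed.

Lemma permute_mxM S s u : permute_mx R d S (s * u)%g = permute_mx R d S s *m permute_mx R d
  S u :> 'M[C]_NW.
Proof. by have [_ ->] := permute_mx_repr R d n S; rewrite ?inE. Qed.

Lemma permute_idxC S T s u w : [disjoint S & T] ->
  permute_idx S s (permute_idx T u w) = permute_idx T u (permute_idx S s w).
Proof.
move=> dST; apply/ffunP => t; apply/ffunP => j; rewrite !ffunE.
by case jS: (j \in S); case jT: (j \in T); try (by have := disjointFr dST jS; rewrite jT);
  do ?rewrite !(ffunE, jS, jT).
Qed.

Lemma permute_idxU S T s w : [disjoint S & T] ->
  permute_idx (S :|: T) s w = permute_idx S s (permute_idx T s w).
Proof.
move=> dST; apply/ffunP => t; apply/ffunP => j; rewrite !ffunE inE.
by case jS: (j \in S); case jT: (j \in T); try (by have := disjointFr dST jS; rewrite jT);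
  do ?rewrite !(ffunE, jS, jT).
Qed.

Lemma permute_mxC S T s u : [disjoint S & T] ->
  permute_mx R d S s *m permute_mx R d T u = permute_mx R d T u *m permute_mx R d S s :> 'M[C]_NW.
Proof.
by move=> dST; apply: basis_word_mx => w; rewrite !mulmxA !basis_word_permute (permute_idxC
  s u w dST).
Qed.

Lemma permute_mxU S T s : [disjoint S & T] ->
  permute_mx R d (S :|: T) s = permute_mx R d S s *m permute_mx R d T s :> 'M[C]_NW.
Proof.
move=> dST; apply: basis_word_mx => w; rewrite mulmxA !basis_word_permute permute_idxU //.
by rewrite (permute_idxC s s w dST).
Qed.

Lemma permute_mx_tr S s : (permute_mx R d S s)^T = permute_mx R d S s^-1%g :> 'M[C]_NW.
Proof.
apply/matrixP => i j; rewrite !mxE; congr (nat_of_bool _)%:R.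
apply/idP/idP => /eqP ->; first by rewrite -permute_idxM mulgV permute_idx1.
by rewrite -permute_idxM mulVg permute_idx1.
Qed.

(** The translation by the odd involution t pairs the terms with opposite signs. *)
Lemma alternating_sum_eq0 (A : {set 'S_n}) (B : 'S_n -> 'rV[C]_NW) (t : 'S_n) :
  t \in A -> odd_perm t -> {in A &, forall x y, (x * y)%g \in A} -> (forall q, B (t * q)%g = B q) ->
  (t * t = 1)%g ->
  \sum_(q in A) (-1) ^+ (q : bool) *: B q = 0.
Proof.
move=> tA ot mA Bt tt; set X := \sum_(q in A) _.
have : X = - X.
  rewrite {1}/X (reindex_inj (mulgI t)) /= -sumrN; apply: eq_big => [q|q _].
    by apply/idP/idP => [qA|qA]; [rewrite -[q]mul1g -tt -mulgA mA|rewrite mA].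
  by rewrite odd_permM ot Bt signr_addb expr1 mulN1r scaleNr.
by move/eqP; rewrite -addr_eq0 -mulr2n -scaler_nat scaler_eq0 pnatr_eq0 /= => /eqP.
Qed.

(** The cells of the first column outnumber the basis of V_S, so that two of them hold
    the same letter on S; their transposition fixes the word and reverses the sign. *)
Lemma col_antisym_eq0 S lam : is_part n lam -> (d ^ #|S| < size lam)%N ->
  \sum_(q in col_stab n lam) (-1) ^+ (q : bool) *: permute_repr R d n S q = 0.
Proof.
case/and3P=> _ lam0 /eqP sumlam lt.
have cell_lt (r : 'I_(size lam)) : (flatten_index lam r 0 < n)%N.
  rewrite -sumlam; apply: flatten_indexP; rewrite lt0n.
  by apply: contraNneq lam0 => <-; rewrite mem_nth.
have row_pos (r : 'I_(size lam)) : (0 < nth 0%N lam r)%N.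
  by rewrite lt0n; apply: contraNneq lam0 => <-; rewrite mem_nth.
pose cell r : 'I_n := Ordinal (cell_lt r).
apply: basis_word_mx => w; rewrite mulmx0 mulmx_sumr.
pose f (r : 'I_(size lam)) : sub_idx d S := res_idx S (w (cell r)).
have /injectivePn[r [r' rr' frr']] : ~~ injectiveb f.
  apply/injectiveP => /leq_card; rewrite card_ord card_ffun card_ord card_sig.
  by rewrite leqNgt (_ : #|[pred x in S]| = #|S|) ?lt //; apply: eq_card.
pose t := tperm (cell r) (cell r').
have crr' : cell r != cell r'.
  apply: contra_neq rr' => /(congr1 (fun c : 'I_n => reshape_index lam c)) /=.
  by rewrite !flatten_indexKl // => /val_inj.
have wt : permute_idx S t w = w.
  apply/ffunP => i; apply/ffunP => j; rewrite !ffunE tpermV; case: ifP => // jS.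
  move/ffunP: frr' => /(_ (exist _ j jS)); rewrite !ffunE /= => E.
  by rewrite /t; case: tpermP => [->|->|].
have tC : t \in col_stab n lam.
  rewrite inE; apply/forallP => i; rewrite /t.
  by case: tpermP => [->|->|//] /=; rewrite !flatten_indexKr.
rewrite (eq_bigr (fun q : 'S_n => (-1) ^+ q *: basis_word (permute_idx S q w))); last first.
  by move=> q _; rewrite -scalemxAr basis_word_permute.
apply: (alternating_sum_eq0 tC).
- by rewrite odd_tperm.
- by move=> x y; apply: col_stabM.
- by move=> q; rewrite permute_idxM wt.
- by rewrite tperm2.
Qed.

Section Embedding.
Variables (S : {set 'I_k}) (lam : seq nat) (w0 : word).
Hypothesis stab : forall s, (permute_idx S s w0 == w0) = (s \in row_stab n lam).
Local Notation Sp := (specht_mod C n lam).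
Local Notation ys := (young_symmetrizer C n lam).

(** The equivariant map from the group algebra to tensors sending 1 to the word w0. *)
Definition word_orbit : 'M[C]_(#|[set: 'S_n]%SET|, NW) :=
  \matrix_i basis_word (permute_idx S (enum_val i) w0).

Definition word_antisym : 'rV[C]_NW :=
  \sum_(q in col_stab n lam) (-1) ^+ (q : bool) *: basis_word (permute_idx S q w0).

Lemma delta_orbit s : delta_mx 0 (gi s) *m word_orbit = basis_word (permute_idx S s w0).
Proof. by rewrite -rowE rowK gring_indexK ?inE. Qed.

Lemma word_orbit_eqv s : reg s *m word_orbit = word_orbit *m permute_repr R d n S s.
Proof.
apply/row_matrixP => i; rewrite !row_mul rowK delta_orbit rowK basis_word_permute.
by rewrite permute_idxM.
Qed.

(** The row symmetrizer, the left factor of the Young symmetrizer, only multiplies w0 by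
    a scalar. *)
Lemma young_orbit : ys *m word_orbit = #|row_stab n lam|%:R *: word_antisym.
Proof.
rewrite /young_symmetrizer mulmx_suml (eq_bigr (fun=> word_antisym)) => [|p pR].
  by rewrite sumr_const scaler_nat.
rewrite mulmx_suml; apply: eq_bigr => q _; rewrite -scalemxAl delta_orbit permute_idxM.
by rewrite (eqP (_ : permute_idx S p w0 == w0)) // stab.
Qed.

(** The elements of the Specht module are left multiples of the row symmetrizer, hence
    constant on the cosets of the row stabilizer. *)
Lemma specht_row_inv (x : 'rV[C]_#|[set: 'S_n]%SET|) p s : p \in row_stab n lam -> (x <= Sp)%MS ->
  x 0 (gi (p * s)%g) = x 0 (gi s) :> C.
Proof.
move=> pR xSp.
pose L : 'M[C]_#|[set: 'S_n]%SET| := \matrix_i delta_mx 0 (gi (p^-1 * enum_val i)%g).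
have dL u : delta_mx 0 (gi u) *m L = delta_mx 0 (gi (p^-1 * u)%g) :> 'rV[C]__.
  by rewrite -rowE rowK gring_indexK ?inE.
have LE (y : 'rV_#|[set: 'S_n]%SET|) : (y *m L) 0 (gi s) = y 0 (gi (p * s)%g).
  rewrite mxE (bigD1 (gi (p * s)%g)) //= !mxE gring_indexK ?inE // mulKg !eqxx mulr1.
  rewrite big1 ?addr0 // => i ne; rewrite !mxE eqxx /=; case: eqP => [E|]; last by rewrite mulr0.
  have := congr1 enum_val E; rewrite !gring_indexK ?inE // => Es.
  by case/negP: ne; rewrite Es mulKVg gring_valK.
have cL u : reg u *m L = L *m reg u.
  apply/row_matrixP => i; rewrite !row_mul !rowK dL.
  by rewrite delta_reg mulgA.
have ysL : ys *m L = ys.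
  rewrite /young_symmetrizer mulmx_suml [RHS](reindex_inj (mulgI p^-1%g)) /=.
  apply: eq_big => [r|r rR].
    apply/idP/idP => [rR|rR]; first by rewrite row_stabM ?row_stabV.
    by rewrite -[r](mulKVg p) row_stabM.
  rewrite mulmx_suml; apply: eq_bigr => q _.
  by rewrite -scalemxAl dL mulgA.
have : (Sp <= kermx (L - 1%:M))%MS.
  apply: cyclic_mx_sub; last by apply/sub_kermxP; rewrite mulmxBr mulmx1 ysL subrr.
  apply/mxmoduleP => u _; apply/sub_kermxP.
  by rewrite -mulmxA mulmxBr mulmx1 cL -[X in L *m _ - X]mul1mx -mulmxBl mulmxA mulmx_ker mul0mx.
move/(submx_trans xSp)/sub_kermxP; rewrite mulmxBr mulmx1 => /eqP; rewrite subr_eq0 => /eqP E.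
by rewrite -LE E.
Qed.

(** Two permutations send w0 to the same word exactly when they lie in the same coset of
    the row stabilizer, on which x is constant; so the coefficients of the image are the
    values of x times #|row_stab|. *)
Lemma word_orbit_inj (x : 'rV_#|[set: 'S_n]%SET|) : (x <= Sp)%MS -> x *m word_orbit = 0 -> x = 0.
Proof.
move=> xSp xPhi; apply/rowP => m; rewrite mxE -[m]gring_valK; set h := enum_val m.
move/rowP: xPhi => /(_ (enum_rank (permute_idx S h w0))); rewrite !mxE.
rewrite (reindex (fun u : 'S_n => gi u)) /=; last first.
  exists enum_val => [u _|j _]; [by rewrite gring_indexK ?inE | exact: gring_valK].
rewrite (reindex_inj (mulIg h)) /= (bigID (fun u => u \in row_stab n lam)) /= addrC big1 ?add0r.
  rewrite (eq_bigr (fun=> x 0 (gi h))) => [|u uR].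
    rewrite sumr_const -mulr_natl => /eqP; rewrite mulf_eq0 pnatr_eq0 =>
      /orP[/eqP/card0_eq|/eqP //].
    by move/(_ 1%g); rewrite (stab1 n lam).
  rewrite mxE gring_indexK ?inE // mxE eqxx permute_idxM.
  by rewrite (eqP (_ : permute_idx S u w0 == w0)) ?stab // eqxx mulr1 specht_row_inv.
move=> u uR; rewrite mxE gring_indexK ?inE // mxE eqxx /= (inj_eq enum_rank_inj) permute_idxM.
by rewrite (inj_eq (@permute_idx_inj _ _)) eq_sym stab (negPf uR) mulr0.
Qed.

Lemma specht_orbit_sub : (Sp *m word_orbit <= isotypic (permute_repr R d n S) lam)%MS.
Proof. exact: (isotypic_hom word_orbit_eqv word_orbit_inj). Qed.

Lemma word_antisym_specht : (word_antisym <= Sp *m word_orbit)%MS.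
Proof.
have c0 : #|row_stab n lam|%:R != 0 :> C.
  by rewrite pnatr_eq0 -lt0n; apply/card_gt0P; exists 1%g; rewrite stab1.
rewrite -[word_antisym]scale1r -(mulVf c0) -scalerA -young_orbit scalemx_sub //.
by rewrite submxMr // cyclic_mx_id.
Qed.

Lemma specht_orbit_module : mxmodule (permute_repr R d n S) (Sp *m word_orbit).
Proof.
apply/mxmoduleP => s sG; rewrite -mulmxA -word_orbit_eqv mulmxA submxMr //.
exact: mxmoduleP (cyclic_mx_module reg ys) s sG.
Qed.

Lemma word_antisym_sub : (word_antisym <= isotypic (permute_repr R d n S) lam)%MS.
Proof. exact: submx_trans word_antisym_specht specht_orbit_sub. Qed.

End Embedding.

Lemma isotypic_size S lam : is_part n lam ->
  isotypic (permute_repr R d n S) lam != 0 -> (size lam <= d ^ #|S|)%N.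
Proof.
move=> part; apply: contraNT; rewrite -ltnNge => lt; apply/eqP/isotypic_eq0.
  by move=> m m0; rewrite pnatr_eq0 -lt0n.
exact: col_antisym_eq0.
Qed.

End Words.

(** * The doubly antisymmetric tensor *)

(** Q Q^* and Q have the same rank, because z Q Q^* = 0 implies that z Q has norm
    zero. *)
Lemma gram_sub (C : numClosedFieldType) m n (Q : 'M[C]_(m, n)) : (Q^t* <= Q *m Q^t*)%MS.
Proof.
have inj p (z : 'M_(p, m)) : z *m Q *m Q^t* = 0 -> z *m Q = 0.
  move=> zQ; apply/eqP; rewrite -frob_eq0 frob_trace trmxC_mul mulmxA zQ mul0mx.
  by rewrite mxtrace0.
have rk : \rank (Q *m Q^t*) = \rank (Q^t*).
  rewrite mxrank_map mxrank_tr // -(mxrank_mul_ker Q (Q^t*)).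
  suff -> : (Q :&: kermx (Q^t*))%MS = 0 by rewrite mxrank0 addn0.
  apply/eqP; rewrite -submx0; apply/row_subP => i.
  have /submxP[z Ez] : (row i (Q :&: kermx (Q^t*)) <= Q)%MS.
    exact: submx_trans (row_sub _ _) (capmxSl _ _).
  have : (row i (Q :&: kermx (Q^t*)) <= kermx (Q^t*))%MS.
    exact: submx_trans (row_sub _ _) (capmxSr _ _).
  by rewrite Ez => /sub_kermxP /inj ->; rewrite sub0mx.
by rewrite -(geq_leqif (mxrank_leqif_sup (submxMl _ _))) rk.
Qed.

Section Biantisym.
Variables (R : realType) (k d n : nat).
Local Notation C := R[i].
Local Notation word := (pow_idx k d n).
Local Notation NW := #|{: word}|.
Local Notation P S s := (permute_mx R d S s).
Local Notation e w := (basis_word R w).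
Implicit Types (S T J : {set 'I_k}) (s u p q : 'S_n) (w v y a : word).

Definition antisym S : 'M[C]_NW := \sum_(s : 'S_n) (-1) ^+ (s : bool) *: P S s.

(** For n equal to the dimensions of both sides, and w a word listing a basis of each,
    this is the polarized determinant of the flattening across S. *)
Definition biantisym S w : 'rV[C]_NW := e w *m antisym S *m antisym (~: S).

Lemma antisym_permutel S s : P S s *m antisym S = (-1) ^+ (s : bool) *: antisym S.
Proof.
rewrite /antisym mulmx_sumr scaler_sumr [RHS](reindex_inj (mulgI s)) /=.
apply: eq_bigr => u _; rewrite -scalemxAr -permute_mxM scalerA odd_permM signr_addb.
by rewrite mulrA -signr_addb addbb mul1r.
Qed.

Lemma antisym_permuter S s : antisym S *m P S s = (-1) ^+ (s : bool) *: antisym S.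
Proof.
rewrite /antisym mulmx_suml scaler_sumr [RHS](reindex_inj (mulIg s)) /=.
apply: eq_bigr => u _; rewrite -scalemxAl -permute_mxM scalerA odd_permM signr_addb.
by rewrite mulrCA -signr_addb addbb mulr1.
Qed.

Lemma disjointC S : [disjoint S & ~: S].
Proof. by rewrite -setI_eq0 setICr. Qed.

Lemma antisym_permuteC S T s : [disjoint S & T] -> antisym S *m P T s = P T s *m antisym S.
Proof.
move=> dST; rewrite /antisym mulmx_suml mulmx_sumr; apply: eq_bigr => u _.
by rewrite -scalemxAl -scalemxAr permute_mxC.
Qed.

Lemma antisymC S T : [disjoint S & T] -> antisym S *m antisym T = antisym T *m antisym S.
Proof.
move=> dST; rewrite mulmx_suml mulmx_sumr; apply: eq_bigr => u _.
by rewrite -scalemxAl -scalemxAr [in RHS]antisym_permuteC // disjoint_sym.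
Qed.

Lemma biantisymC S w : biantisym (~: S) w = biantisym S w.
Proof. by rewrite /biantisym setCK -!mulmxA antisymC // disjoint_sym disjointC. Qed.

(** Hence the choice of the word w matters only up to sign. *)
Lemma biantisym_permute S s w :
  biantisym S (permute_idx S s w) = (-1) ^+ (s : bool) *: biantisym S w.
Proof.
by rewrite /biantisym -basis_word_permute -(mulmxA (e w)) antisym_permutel -scalemxAr -scalemxAl.
Qed.

(** A simultaneous permutation of both sides contributes its sign twice. *)
Lemma biantisym_diag S w s : biantisym S w *m P [set: 'I_k]%SET s = biantisym S w.
Proof.
rewrite -(setUCr S) permute_mxU ?disjointC // mulmxA /biantisym.
rewrite -(mulmxA _ (antisym (~: S))) antisym_permuteC; last by rewrite disjoint_sym disjointC.
rewrite mulmxA -(mulmxA _ (antisym S)) antisym_permuter -!mulmxA.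
rewrite antisym_permuter -scalemxAr -!scalemxAl -!scalemxAr scalerA -signr_addb addbb.
by rewrite scale1r.
Qed.

Lemma biantisym_sum S w : biantisym S w = \sum_(s : 'S_n) \sum_(u : 'S_n)
  (-1) ^+ (s (+) u) *: e (permute_idx S s (permute_idx (~: S) u w)).
Proof.
rewrite /biantisym -mulmxA mulmx_suml mulmx_sumr; apply: eq_bigr => s _.
rewrite mulmx_sumr mulmx_sumr; apply: eq_bigr => u _.
rewrite -!(scalemxAl, scalemxAr) scalerA mulmxA basis_word_permute basis_word_permute.
by rewrite signr_addb (permute_idxC s u w (disjointC S)) mulrC.
Qed.

Lemma biantisym_real S w : map_mx Num.conj (biantisym S w) = biantisym S w.
Proof.
rewrite biantisym_sum !raddf_sum; apply: eq_bigr => s _; rewrite raddf_sum /=.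
apply: eq_bigr => u _; rewrite map_mxZ rmorph_sign; congr (_ *: _).
by rewrite /basis_word map_delta_mx.
Qed.

(** For the one-column partition the row stabilizer is trivial and the column stabilizer
    is the whole group, so that [antisym] is the column antisymmetrizer. *)
Lemma biantisym_full S w : (forall s, (permute_idx S s w == w) = (s == 1%g)) ->
  (biantisym S w <= isotypic (permute_repr R d n S) (nseq n 1%N))%MS.
Proof.
move=> inj.
have cell (i : 'I_n) : (0 < nth 0 (nseq n 1) i)%N by rewrite nth_nseq ltn_ord.
have rI (i : 'I_n) : reshape_index (nseq n 1%N) i = i.
  rewrite -[RHS](flatten_indexKl (cell i)); congr reshape_index.
  by rewrite /flatten_index take_nseq ?(ltnW (ltn_ord i)) // sumn_nseq mul1n addn0.
have rO (i : 'I_n) : reshape_offset (nseq n 1%N) i = 0%N.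
  rewrite -[RHS](flatten_indexKr (cell i)); congr reshape_offset.
  by rewrite /flatten_index take_nseq ?(ltnW (ltn_ord i)) // sumn_nseq mul1n addn0.
have colT s : s \in col_stab n (nseq n 1%N).
  by rewrite inE; apply/forallP => i; rewrite !rO.
have row1 s : (s \in row_stab n (nseq n 1%N)) = (s == 1%g).
  rewrite inE; apply/forallP/eqP => [h|-> i]; last by rewrite perm1.
  by apply/permP => i; apply/val_inj; have := h i; rewrite !rI perm1 => /eqP.
rewrite biantisym_sum exchange_big summx_sub //= => u _.
set w' := permute_idx (~: S) u w.
have -> : \sum_(s : 'S_n) (-1) ^+ (s (+) u) *: e (permute_idx S s w')
  = (-1) ^+ u *: word_antisym R S (nseq n 1%N) w'.
  rewrite /word_antisym scaler_sumr; apply: eq_big => [s|s _]; first by rewrite colT.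
  by rewrite scalerA -signr_addb addbC.
rewrite scalemx_sub // word_antisym_sub // => s; rewrite row1 -inj /w'.
by rewrite (permute_idxC s u w (disjointC S)) (inj_eq (@permute_idx_inj _ _ _ _ _)).
Qed.

Section Leg.
Variables (J J' : {set 'I_k}) (lam : seq nat) (w : word).
Local Notation S := (J :|: J').
Hypothesis dJ : [disjoint J & J'].
Hypothesis stabJ : forall s, (permute_idx J s w == w) = (s \in row_stab n lam).
Hypothesis stabJ' : forall s, (permute_idx J' s w == w) = (s \in col_stab n lam).
Hypothesis stabC : forall s, (permute_idx (~: S) s w == w) = (s == 1%g).
Local Notation Cs := (col_stab n lam).

Lemma disjoint_leg : [disjoint J & ~: S] * [disjoint J' & ~: S].
Proof.
by split; rewrite disjoints_subset setCK ?subsetUl ?subsetUr.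
Qed.

(** A column permutation does not move the J'-letters of w; on S it acts as on J
    alone. *)
Lemma permute_stab q s u : q \in Cs ->
  permute_idx S (q * s)%g (permute_idx (~: S) u w)
  = permute_idx J s (permute_idx J q (permute_idx J' s (permute_idx (~: S) u w))).
Proof.
rewrite -stabJ' => /eqP qw; have [dJC dJC'] := disjoint_leg.
rewrite permute_idxU // permute_idxM; congr (permute_idx _ _ (permute_idx _ _ _)).
by rewrite permute_idxM (permute_idxC q u w dJC') qw.
Qed.

(** The sum over all permutations of S is grouped into cosets of the column stabilizer,
    and on each coset only the J-letters are antisymmetrized. *)
Lemma biantisym_leg_sum : #|Cs|%:R *: biantisym S w = \sum_(s : 'S_n) \sum_(u : 'S_n)
  (-1) ^+ (s (+) u) *: (word_antisym R J lam (permute_idx J' s (permute_idx (~: S) u w)) *m P J s).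
Proof.
rewrite scaler_nat -sumr_const.
rewrite (eq_bigr (fun q : 'S_n => \sum_(s : 'S_n) \sum_(u : 'S_n)
  (-1) ^+ (s (+) u) *: ((-1) ^+ q *: e (permute_idx J s (permute_idx J q
     (permute_idx J' s (permute_idx (~: S) u w))))))); last first.
  move=> q qC; rewrite biantisym_sum (reindex_inj (mulgI q)) /=.
  apply: eq_bigr => s _; apply: eq_bigr => u _; rewrite permute_stab // scalerA.
  by rewrite odd_permM -signr_addb -addbA [(_ : bool) (+) (s (+) u)]addbC.
rewrite exchange_big; apply: eq_bigr => s _; rewrite exchange_big; apply: eq_bigr => u _.
rewrite -scaler_sumr; congr (_ *: _); rewrite /word_antisym mulmx_suml.
by apply: eq_bigr => q _; rewrite -scalemxAl basis_word_permute.
Qed.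

Lemma card_stab_neq0 : #|Cs|%:R != 0 :> C.
Proof. by rewrite pnatr_eq0 -lt0n; apply/card_gt0P; exists 1%g; rewrite stab1. Qed.

Lemma biantisym_leg : (biantisym S w <= isotypic (permute_repr R d n J) lam)%MS.
Proof.
rewrite -[biantisym S w]scale1r -(mulVf card_stab_neq0) -scalerA scalemx_sub //.
rewrite biantisym_leg_sum; apply: summx_sub => s _; apply: summx_sub => u _.
rewrite scalemx_sub //; set w' := permute_idx J' _ _.
have stab' p : (permute_idx J p w' == w') = (p \in row_stab n lam).
  rewrite -stabJ /w'; have [dJC _] := disjoint_leg.
  rewrite (permute_idxC p s _ dJ) (permute_idxC p u _ dJC).
  by rewrite (inj_eq (@permute_idx_inj _ _ _ _ _)) (inj_eq (@permute_idx_inj _ _ _ _ _)).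
apply: submx_trans _ (specht_orbit_sub R stab').
apply: (mxmodule_trans (specht_orbit_module R J lam w')); rewrite ?inE //.
exact: word_antisym_specht.
Qed.

Local Notation u := (biantisym S w).

Definition mix v y : word := [ffun t => [ffun j => if j \in J then v t j else y t j]].

Lemma mix_id v : mix v v = v.
Proof. by apply/ffunP => t; apply/ffunP => j; rewrite !ffunE if_same. Qed.

Lemma mix_mixl v y z : mix (mix v y) z = mix v z.
Proof. by apply/ffunP => t; apply/ffunP => j; rewrite !ffunE; case jJ: (j \in J); rewrite
  ?(ffunE, jJ). Qed.

Lemma mix_mixr v y z : mix v (mix y z) = mix v z.
Proof. by apply/ffunP => t; apply/ffunP => j; rewrite !ffunE; case jJ: (j \in J); rewrite
  ?(ffunE, jJ). Qed.

Lemma mix_permutel v y s : mix (permute_idx J s v) y = permute_idx J s (mix v y).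
Proof. by apply/ffunP => t; apply/ffunP => j; rewrite !ffunE; case jJ: (j \in J); rewrite
  ?(ffunE, jJ). Qed.

Lemma mix_permute_out T v y s : [disjoint J & T] -> mix (permute_idx T s v) y = mix v y.
Proof.
move=> dT; apply/ffunP => t; apply/ffunP => j; rewrite !ffunE; case jJ: (j \in J) => //.
by rewrite ?ffunE (disjointFr dT jJ).
Qed.

Lemma mix_permuter T v y s : [disjoint J & T] -> mix v (permute_idx T s y) = permute_idx T
  s (mix v y).
Proof.
move=> dT; apply/ffunP => t; apply/ffunP => j; rewrite !ffunE; case jJ: (j \in J).
  by rewrite (disjointFr dT jJ) ?(ffunE, jJ).
by case: ifP => jT; rewrite ?(ffunE, jJ).
Qed.

Lemma mix_permute_in v y s : mix v (permute_idx J s y) = mix v y.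
Proof. by apply/ffunP => t; apply/ffunP => j; rewrite !ffunE; case jJ: (j \in J); rewrite
  ?(ffunE, jJ). Qed.

(** Keeps the words whose letters outside J are those of y, and replaces these letters
    by those of the reference word w. Thus u *m slice_mx y is the slice of u at y, as a
    tensor on J. *)
Definition slice_mx y : 'M[C]_NW :=
  \matrix_i ((mix w (enum_val i) == mix w y)%:R *: e (mix (enum_val i) w)).

Lemma slice_mxE v y : e v *m slice_mx y = (mix w v == mix w y)%:R *: e (mix v w).
Proof. by rewrite -rowE rowK enum_rankK. Qed.

Lemma slice_word s p y : e (permute_idx S s (permute_idx (~: S) p w)) *m slice_mx y =
  (permute_idx J' s (permute_idx (~: S) p w) == mix w y)%:R *: e (permute_idx J s w).
Proof.
have [dJC dJC'] := disjoint_leg.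
rewrite slice_mxE permute_idxU // mix_permute_in mix_permutel.
by rewrite mix_permuter // mix_permuter // mix_id mix_permute_out // mix_permute_out // mix_id.
Qed.

(** In [biantisym_leg_sum] every term is a translate of the word antisymmetrized on J,
    and slicing only selects terms. *)
Lemma slice_specht y : (u *m slice_mx y <= specht_mod C n lam *m word_orbit R J w)%MS.
Proof.
rewrite -[u]scale1r -(mulVf card_stab_neq0) -scalerA -scalemxAl scalemx_sub //.
rewrite biantisym_leg_sum mulmx_suml; apply: summx_sub => s _; rewrite mulmx_suml.
apply: summx_sub => p _; rewrite -scalemxAl scalemx_sub //.
have [dJC dJC'] := disjoint_leg.
have -> : word_antisym R J lam (permute_idx J' s (permute_idx (~: S) p w)) *m P J s *m slice_mx y
  = (permute_idx J' s (permute_idx (~: S) p w) == mix w y)%:R *: (word_antisym R J lam w *m P J s).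
  rewrite /word_antisym !mulmx_suml scaler_sumr; apply: eq_bigr => q qC.
  rewrite -!scalemxAl scalerA mulrC -scalerA; congr (_ *: _).
  rewrite basis_word_permute -permute_stab // slice_word basis_word_permute -permute_idxM.
  congr ((_ == _)%:R *: _); rewrite permute_idxM.
  rewrite (permute_idxC q p w dJC').
  by move: qC; rewrite -stabJ' => /eqP ->.
rewrite scalemx_sub //; apply: (mxmodule_trans (specht_orbit_module R J lam w)); rewrite ?inE //.
exact: word_antisym_specht.
Qed.

(** The letters of w outside J are preserved exactly by the column permutations of J',
    with the identity on the complement of S. *)
Lemma slice_self : u *m slice_mx w = word_antisym R J lam w.
Proof.
have [dJC dJC'] := disjoint_leg.
rewrite biantisym_sum mulmx_suml /word_antisym [RHS]big_mkcond /=; apply: eq_bigr => s _.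
rewrite mulmx_suml (bigD1 1%g) //= big1 ?addr0 => [|p p1].
  rewrite -scalemxAl slice_word permute_idx1 mix_id stabJ' odd_perm1 addbF.
  by case: ifP => _; rewrite ?scale1r // scale0r scaler0.
rewrite -scalemxAl slice_word mix_id; case: eqP => [E|_]; last by rewrite scale0r scaler0.
case/negP: p1; rewrite -stabC; apply/eqP/ffunP => t; apply/ffunP => j.
case jC: (j \in ~: S); last by rewrite !ffunE jC.
have /ffunP/(_ t)/ffunP/(_ j) := E; rewrite !ffunE.
have -> : j \in J' = false by apply/negP => jJ; have := disjointFr dJC' jJ; rewrite jC.
by rewrite ?ffunE jC.
Qed.

(** The transpose of the contraction with u, from tensors on J to tensors on the
    complement of J. The word a only fixes the J-letters of the target. *)
Definition cross_mx a : 'M[C]_NW :=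
  \matrix_i ((mix a (enum_val i) == enum_val i)%:R *: (u *m slice_mx (enum_val i))).

Lemma cross_mxE a v : e v *m cross_mx a = (mix a v == v)%:R *: (u *m slice_mx v).
Proof. by rewrite -rowE rowK enum_rankK. Qed.

Lemma disjointJC : [disjoint J & ~: J]. Proof. exact: disjointC. Qed.

(** The tensor u is invariant under simultaneous permutations, so that permuting y on
    the complement of J amounts to permuting the slice on J. *)
Lemma cross_mx_eqv a s : cross_mx a *m P J s = P (~: J) s *m cross_mx a.
Proof.
apply: basis_word_mx => v; rewrite !mulmxA basis_word_permute !cross_mxE.
rewrite mix_permuter ?disjointJC // (inj_eq (@permute_idx_inj _ _ _ _ _)) -scalemxAl; congr
  (_ *: _).
have sl : P (~: J) s *m slice_mx (permute_idx (~: J) s v) = slice_mx v.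
  apply: basis_word_mx => y; rewrite mulmxA basis_word_permute !slice_mxE.
  rewrite !mix_permuter ?disjointJC // (inj_eq (@permute_idx_inj _ _ _ _ _)).
  by rewrite mix_permute_out ?disjointJC.
have slC : slice_mx v *m P J s = P J s *m slice_mx v.
  apply: basis_word_mx => y; rewrite !mulmxA basis_word_permute !slice_mxE.
  by rewrite -scalemxAl basis_word_permute mix_permute_in mix_permutel.
rewrite -[u in RHS](biantisym_diag _ _ s) -(setUCr J) permute_mxU ?disjointJC //.
by rewrite -!mulmxA sl slC.
Qed.

(** The slices lie in the copy of the Specht module generated by the slice at w. *)
Lemma cross_mx_specht a : (cross_mx a :=: specht_mod C n lam *m word_orbit R J w)%MS.
Proof.
apply/eqmxP/andP; split.
  by apply/row_subP => i; rewrite rowK scalemx_sub // slice_specht.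
apply: (cyclic_hom_sub (rG := permute_repr R d n J)).
- exact: word_orbit_eqv.
- by apply/mxmoduleP => s _; rewrite cross_mx_eqv submxMl.
rewrite young_orbit // scalemx_sub // -slice_self.
have -> : u *m slice_mx w = e (mix a w) *m cross_mx a.
  rewrite cross_mxE mix_mixr eqxx scale1r; congr (_ *m _); apply: basis_word_mx => v.
  by rewrite !slice_mxE mix_mixr.
exact: submxMl.
Qed.

Lemma cross_mx_tr a : (cross_mx a)^t* = (cross_mx a)^T.
Proof.
have rl v : map_mx Num.conj (slice_mx v) = slice_mx v.
  by apply/matrixP => i j; rewrite !mxE rmorphM !rmorph_nat.
rewrite -map_trmx; congr (_^T); apply/row_matrixP => m.
by rewrite -map_row rowK map_mxZ rmorph_nat map_mxM rl biantisym_real.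
Qed.

(** The rows of the transposed matrix span the image of its own row space, a copy of the
    Specht module, under the contraction ([gram_sub]). The contraction is injective
    there: since the matrix is real, a vector z Q with z Q Q^T = 0 has norm zero. *)
Lemma cross_mx_isotypic a :
  ((cross_mx a)^T <= isotypic (permute_repr R d n (~: J)) lam)%MS.
Proof.
pose F := word_orbit R J w *m (cross_mx a)^T.
have Feqv s : regular_repr C [set: 'S_n]%G s *m F = F *m permute_repr R d n (~: J) s.
  rewrite /F mulmxA word_orbit_eqv -!mulmxA; congr (_ *m _) => /=.
  rewrite -[P J s]trmxK -[P (~: J) s]trmxK -!trmx_mul; congr (_^T).
  by rewrite !permute_mx_tr cross_mx_eqv.
have Finj (x : 'rV_#|[set: 'S_n]%SET|) : (x <= specht_mod C n lam)%MS -> x *m F = 0 -> x = 0.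
  move=> xSp; rewrite /F mulmxA => xF; apply: (word_orbit_inj stabJ xSp).
  have : (x *m word_orbit R J w <= cross_mx a)%MS by rewrite cross_mx_specht submxMr.
  case/submxP => z Ez; apply/eqP; rewrite -frob_eq0 frob_trace {2}Ez trmxC_mul cross_mx_tr.
  by rewrite mulmxA xF mul0mx mxtrace0.
apply: submx_trans (isotypic_hom Feqv Finj).
rewrite /F mulmxA -(eqmxMr _ (cross_mx_specht a)) -cross_mx_tr.
exact: gram_sub.
Qed.

(** The words on J, extended by w outside J, enumerate the slices of u in the other
    direction. *)
Lemma biantisym_cross : u = \sum_(a | mix a w == a) e a *m (cross_mx a)^T.
Proof.
apply/rowP => m; rewrite summxE -[m]enum_valK; set v := enum_val m.
have sl x y : (u *m slice_mx y) 0 (enum_rank x) = (mix x w == x)%:R * u 0 (enum_rank (mix x y)).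
  (* The only word contributing to the coefficient of x is the one extended by y. *)
  have slE z : slice_mx y (enum_rank z) (enum_rank x) = ((mix w z == mix w y) && (x == mix z w))%:R.
    by rewrite mxE enum_rankK !mxE eqxx (inj_eq enum_rank_inj) -natrM mulnb.
  rewrite mxE (reindex (@enum_rank word)) /=; last exact/onW_bij/enum_rank_bij.
  rewrite (bigD1 (mix x y)) //= slE mix_mixr mix_mixl eqxx /= [X in _ + X]big1 ?addr0 => [|z ne].
    by rewrite mulrC eq_sym.
  rewrite slE; case: eqP => [E|]; last by rewrite mulr0.
  case: eqP => [Ex|]; last by rewrite mulr0.
  case/negP: ne; apply/eqP.
  by rewrite Ex mix_mixl -[LHS]mix_id -(mix_mixr _ w) E mix_mixr.
have cE a : (e a *m (cross_mx a)^T) 0 (enum_rank v)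
    = (mix a v == v)%:R * ((mix a w == a)%:R * u 0 (enum_rank (mix a v))).
  rewrite -sl; have := cross_mxE a v; rewrite -!rowE => /rowP/(_ (enum_rank a)).
  by rewrite [LHS]mxE [RHS]mxE => <-; rewrite mxE mxE.
rewrite (bigD1 (mix v w)) /= ?mix_mixl // cE !mix_mixl !mix_id !eqxx !mul1r.
rewrite big1 ?addr0 // => a /andP[/eqP aw ne]; rewrite cE.
case: eqP => [E|]; last by rewrite mul0r.
by case/negP: ne; rewrite -E mix_mixl aw.
Qed.

Lemma biantisym_leg_compl : (u <= isotypic (permute_repr R d n (~: J)) lam)%MS.
Proof.
rewrite biantisym_cross; apply: summx_sub => a _.
exact: submx_trans (submxMl _ _) (cross_mx_isotypic a).
Qed.

End Leg.

End Biantisym.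

(** * The determinant as an isotypic tensor *)

Section Cells.
Variables (R : realType) (d : nat).
Local Notation C := R[i].
Local Notation N := (d * d)%N.
Implicit Types (s : 'S_4) (t : 'I_N) (p g : 'S_N).

Definition row_of t : 'I_d := (mxtens_unindex t).1.
Definition col_of t : 'I_d := (mxtens_unindex t).2.

(** Each side of the bipartition lists the cells of a d by d square, so that one leg reads
    off the rows, and its partner the columns, of the tableau of shape (d^d). *)
Definition cell_word s : pow_idx 4 d N :=
  [ffun t => legs_idx s (row_of t, col_of t, row_of t, col_of t)].

Lemma cell_wordE s : [/\ forall t, cell_word s t (s o0) = row_of t,
  forall t, cell_word s t (s o1) = col_of t, forall t, cell_word s t (s o2) = row_of t &
  forall t, cell_word s t (s o3) = col_of t].
Proof. by split=> t; rewrite ffunE ?legs_idx0 ?legs_idx1 ?legs_idx2 ?legs_idx3. Qed.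

Lemma cell_inj t t' : row_of t = row_of t' -> col_of t = col_of t' -> t = t'.
Proof.
move=> h h'; apply: (can_inj (@mxtens_unindexK d d)).
by rewrite [LHS]surjective_pairing [RHS]surjective_pairing; congr (_, _).
Qed.

Lemma reshape_rect (t : 'I_N) : reshape_index (nseq d d) t = row_of t :> nat /\
  reshape_offset (nseq d d) t = col_of t :> nat.
Proof.
have -> : t = flatten_index (nseq d d) (row_of t) (col_of t) :> nat.
  rewrite /flatten_index take_nseq ?(ltnW (ltn_ord _)) // sumn_nseq mulnC.
  by rewrite /= -divn_eq.
have c : (col_of t < nth 0 (nseq d d) (row_of t))%N by rewrite nth_nseq !ltn_ord.
by rewrite flatten_indexKl ?flatten_indexKr.
Qed.

Lemma permute_idx_fixP (T : {set 'I_4}) p (w : pow_idx 4 d N) :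
  reflect (forall j, j \in T -> forall t, w (p t) j = w t j) (permute_idx T p w == w).
Proof.
apply: (iffP eqP) => [E j jT t|H].
  by have /ffunP/(_ (p t))/ffunP/(_ j) := E; rewrite !ffunE jT permK => <-.
apply/ffunP => t; apply/ffunP => j; rewrite !ffunE; case: ifP => // jT.
by rewrite -[in RHS](permKV p t) H.
Qed.

Lemma permute_idxE (T : {set 'I_4}) p (w : pow_idx 4 d N) t j :
  permute_idx T p w t j = if j \in T then w (p^-1%g t) j else w t j.
Proof. by rewrite !ffunE. Qed.

Lemma stab_row s p : (permute_idx [set s o0] p (cell_word s) == cell_word s) = (p \in
  row_stab N (nseq d d)).
Proof.
have [w0 _ _ _] := cell_wordE s; rewrite inE; apply/permute_idx_fixP/forallP => [H t|H j
  /set1P-> t].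
  by have := H _ (set11 _) t; rewrite !w0 !(reshape_rect _).1 => ->.
by rewrite !w0; apply/val_inj; have := H t; rewrite !(reshape_rect _).1 => /eqP.
Qed.

Lemma stab_col s p : (permute_idx [set s o1] p (cell_word s) == cell_word s) = (p \in
  col_stab N (nseq d d)).
Proof.
have [_ w1 _ _] := cell_wordE s; rewrite inE; apply/permute_idx_fixP/forallP => [H t|H j
  /set1P-> t].
  by have := H _ (set11 _) t; rewrite !w1 !(reshape_rect _).2 => ->.
by rewrite !w1; apply/val_inj; have := H t; rewrite !(reshape_rect _).2 => /eqP.
Qed.

Lemma stab_front s p : (permute_idx (front s) p (cell_word s) == cell_word s) = (p == 1%g).
Proof.
have [w0 w1 _ _] := cell_wordE s; apply/permute_idx_fixP/eqP => [H|-> j _ t]; last by rewrite perm1.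
apply/permP => t; rewrite perm1; apply: cell_inj.
  by rewrite -!w0 H // mem_front.
by rewrite -!w1 H // mem_front.
Qed.

Lemma stab_back s p : (permute_idx (~: front s) p (cell_word s) == cell_word s) = (p == 1%g).
Proof.
have [_ _ w2 w3] := cell_wordE s; apply/permute_idx_fixP/eqP => [H|-> j _ t]; last by rewrite perm1.
apply/permP => t; rewrite perm1; apply: cell_inj.
  by rewrite -!w2 H // inE mem_front.
by rewrite -!w3 H // inE mem_front.
Qed.

Definition cell_vec s := biantisym R (front s) (cell_word s).

Lemma cell_vec_front s :
  (cell_vec s <= isotypic (permute_repr R d N (front s)) (nseq N 1%N))%MS.
Proof. exact: biantisym_full (stab_front s). Qed.

Lemma disjoint_legs s : [disjoint [set s o0] & [set s o1]].
Proof. by rewrite disjoints1 inE (inj_eq perm_inj). Qed.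

Lemma cell_vec_leg0 s :
  (cell_vec s <= isotypic (permute_repr R d N [set s o0]) (nseq d d))%MS.
Proof. exact: (biantisym_leg R (disjoint_legs s) (stab_row s) (stab_col s)). Qed.

Lemma cell_vec_leg0C s :
  (cell_vec s <= isotypic (permute_repr R d N (~: [set s o0])) (nseq d d))%MS.
Proof.
exact: (biantisym_leg_compl R (disjoint_legs s) (stab_row s) (stab_col s) (stab_back s)).
Qed.

Definition swap_in s : 'S_4 := (tperm o0 o1 * s)%g.
Definition swap_out s : 'S_4 := (tperm o0 o2 * tperm o1 o3 * s)%g.

Lemma swap_inE s : [/\ swap_in s o0 = s o1, swap_in s o1 = s o0, swap_in s o2 = s o2 &
  swap_in s o3 = s o3].
Proof. by rewrite /swap_in; split; rewrite permM ?tpermL ?tpermR ?tpermD. Qed.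

Lemma swap_outE s : [/\ swap_out s o0 = s o2, swap_out s o1 = s o3, swap_out s o2 = s o0 &
  swap_out s o3 = s o1].
Proof.
rewrite /swap_out; split; rewrite !permM.
- by rewrite tpermL tpermD.
- by rewrite (@tpermD _ o0 o2) // tpermL.
- by rewrite tpermR tpermD.
- by rewrite (@tpermD _ o0 o2) // tpermR.
Qed.

(** Exchanging the two legs of a side transposes the square of cells, which is a
    permutation of the letters on that side. *)
Lemma cell_vec_in s : exists b : bool, cell_vec s = (-1) ^+ b *: cell_vec (swap_in s).
Proof.
have [s0 s1 s2 s3] := swap_inE s.
have fr : front (swap_in s) = front s by rewrite /front s0 s1 setUC.
pose f t : 'I_N := mxtens_index (col_of t, row_of t).
have fE t : row_of (f t) = col_of t /\ col_of (f t) = row_of t.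
  by rewrite /row_of /col_of /f mxtens_indexK.
have fK : involutive f.
  move=> t; apply: cell_inj; first by rewrite (fE (f t)).1 (fE t).2.
  by rewrite (fE (f t)).2 (fE t).1.
pose g := perm (inv_inj fK).
have gV : (g^-1 = g)%g.
  by apply/permP => t; apply: (@perm_inj _ g); rewrite permKV !permE fK.
exists (g : bool); rewrite /cell_vec fr -biantisym_permute; congr (biantisym _ _ _).
apply/ffunP => t; apply/ffunP => j; rewrite permute_idxE gV permE.
rewrite -[j](permKV s); move: (s^-1%g j) => i {j}; rewrite mem_front.
have [w0 w1 w2 w3] := cell_wordE s; have [v0 v1 v2 v3] := cell_wordE (swap_in s).
elim/ord4P: i => /=.
- by rewrite w0 -s1 v1 (fE t).2.
- by rewrite w1 -s0 v0 (fE t).1.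
- by rewrite w2 -s2 v2.
- by rewrite w3 -s3 v3.
Qed.

Lemma cell_vec_out s : cell_vec (swap_out s) = cell_vec s.
Proof.
have [s0 s1 s2 s3] := swap_outE s.
have fr : front (swap_out s) = ~: front s.
  apply/setP => j; rewrite -[j](permKV s); move: (s^-1%g j) => i {j}.
  by rewrite [in RHS]inE mem_front /front s0 s1 !inE !(inj_eq perm_inj); elim/ord4P: i.
rewrite /cell_vec fr biantisymC; congr (biantisym _ _ _).
apply/ffunP => t; apply/ffunP => j.
rewrite -[j](permKV s); move: (s^-1%g j) => i {j}.
have [w0 w1 w2 w3] := cell_wordE s; have [v0 v1 v2 v3] := cell_wordE (swap_out s).
elim/ord4P: i.
- by rewrite w0 -s2 v2.
- by rewrite w1 -s3 v3.
- by rewrite w2 -s0 v0.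
- by rewrite w3 -s1 v1.
Qed.

(** The legs other than s 0 are brought into the position of s 0 by [swap_in] and
    [swap_out]. *)
Lemma cell_vec_leg s (j : 'I_4) (T : {set 'I_4}) : T = [set j] \/ T = ~: [set j] ->
  (cell_vec s <= isotypic (permute_repr R d N T) (nseq d d))%MS.
Proof.
have H0 s' : T = [set s' o0] \/ T = ~: [set s' o0] ->
    (cell_vec s' <= isotypic (permute_repr R d N T) (nseq d d))%MS.
  by case=> ->; [exact: cell_vec_leg0|exact: cell_vec_leg0C].
have H1 s' : T = [set s' o1] \/ T = ~: [set s' o1] ->
    (cell_vec s' <= isotypic (permute_repr R d N T) (nseq d d))%MS.
  have [<- _ _ _] := swap_inE s'; have [b ->] := cell_vec_in s'.
  by move=> h; rewrite scalemx_sub // H0.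
have [o2' o3' _ _] := swap_outE s.
rewrite -[j](permKV s); move: (s^-1%g j) => i {j}; elim/ord4P: i.
- exact: H0.
- exact: H1.
- by rewrite -o2' -cell_vec_out; exact: H0.
- by rewrite -o3' -cell_vec_out; exact: H1.
Qed.

Lemma cell_vec_fixed s :
  (cell_vec s <= rfix_mx (permute_repr R d N [set: 'I_4]%SET) [set: 'S_N]%SET)%MS.
Proof. by apply/rfix_mxP => p _; apply: biantisym_diag. Qed.

Lemma tensor_power_basis n (psi : 'rV[C]_#|{: idx 4 d}|) (w : pow_idx 4 d n) :
  (tensor_power n psi *m (basis_word R w)^T) 0 0 = \prod_(t < n) coord psi (w t).
Proof.
rewrite trmx_delta -colE mxE mxE; apply: eq_bigr => t _.
by rewrite enum_rankK.
Qed.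

(** For each permutation p of the front legs, the sum over the permutations of the back
    legs is the Leibniz formula. *)
Lemma cell_vec_pairing s (psi : 'rV[C]_#|{: idx 4 d}|) :
  (tensor_power N psi *m (cell_vec s)^T) 0 0 = N`!%:R * \det (pair_mx s psi).
Proof.
rewrite /cell_vec biantisym_sum raddf_sum mulmx_sumr summxE.
rewrite (eq_bigr (fun=> \det (pair_mx s psi))) => [|p _].
  by rewrite sumr_const card_Sn mulr_natl.
(* The back permutation is written g^-1 p, so that t is moved from front to back by g. *)
have h_inj : injective (fun g : 'S_N => g^-1 * p)%g by move=> g g' /mulIg/invg_inj.
rewrite raddf_sum mulmx_sumr summxE (reindex_inj h_inj) /determinant; apply: eq_bigr => g _.
rewrite /= linearZ /= -scalemxAr mxE tensor_power_basis odd_permM odd_permV.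
rewrite addbC -addbA addbb addbF; congr (_ * _).
rewrite (reindex_inj (@perm_inj _ p)) /=; apply: eq_bigr => t _.
have [w0 w1 w2 w3] := cell_wordE s.
rewrite [RHS]mxE; congr coord; apply/ffunP => j.
rewrite -[j](permKV s); move: (s^-1%g j) => i {j}.
rewrite !permute_idxE in_setC !mem_front invMg invgK !permM !permK.
elim/ord4P: i; rewrite ?(legs_idx0, legs_idx1, legs_idx2, legs_idx3).
- exact: w0.
- exact: w1.
- exact: w2.
- exact: w3.
Qed.

End Cells.

(** * Bipartitions, projections and partitions *)

Section Bipartitions.
Variable k : nat.
Implicit Types b c : bipartition k.

Lemma side_spec b : [/\ val b = [set side b; ~: side b]%SET, side b != finset.set0 & ~:
  side b != finset.set0].
Proof.
have /existsP[S /and3P[S0 ST /eqP bS]] := valP b.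
have sb : side b \in val b.
  rewrite /side; case: pickP => [T //|h] /=.
  by have := h S; rewrite bS set21.
have cS : ~: S != finset.set0 by rewrite -setCT (inj_eq (@setC_inj _)).
by move: sb; rewrite bS => /set2P[->|->]; split; rewrite ?setCK //; apply: setUC.
Qed.

Lemma singleton_side b :
  singleton_bipartition b = (#|side b| == 1%N) || (#|~: side b| == 1%N).
Proof.
have [bE _ _] := side_spec b; rewrite /singleton_bipartition bE.
apply/existsP/orP => [[S /andP[/set2P[->|->] ->]]|[h|h]]; [by left|by right| |].
  by exists (side b); rewrite set21.
by exists (~: side b); rewrite set22.
Qed.

End Bipartitions.

Section FourLegs.
Implicit Types b c : bipartition 4.

Lemma side_card2 b : ~~ singleton_bipartition b -> #|side b| = 2%N /\ #|~: side b| = 2%N.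
Proof.
rewrite singleton_side; have [_] := side_spec b; rewrite -!card_gt0.
have := cardsC (side b); rewrite card_ord.
move: #|side b| #|~: side b| => x y.
by case: x => [|[|[|[|[|x]]]]]; case: y => [|[|[|[|y]]]].
Qed.

(** Nested sides of the same size are equal. *)
Lemma laminar_eq b c : ~~ singleton_bipartition b -> ~~ singleton_bipartition c ->
  mutually_laminar b c -> b = c.
Proof.
move=> /side_card2[b1 b2] /side_card2[c1 c2].
have [bE _ _] := side_spec b; have [cE _ _] := side_spec c.
case/existsP=> X /andP[Xb /existsP[Y /andP[Yc XY]]]; apply: val_inj.
have XYe : X = Y.
  apply/eqP; rewrite eqEcard XY; move: Xb Yc; rewrite bE cE.
  by move=> /set2P[]-> /set2P[]->; rewrite ?b1 ?b2 ?c1 ?c2.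
(* Either side determines the bipartition. *)
have gen (S Z : {set 'I_4}) : Z \in [set S; ~: S]%SET -> [set S; ~: S]%SET = [set Z; ~: Z]%SET.
  by case/set2P=> ->; rewrite // setCK setUC.
by rewrite bE cE (gen _ X) -?bE // (gen (side c) X) // -cE XYe.
Qed.

Lemma front_exists (S : {set 'I_4}) : #|S| = 2%N -> exists s : 'S_4, front s = S.
Proof.
move=> cS; have cS' : #|~: S| = 2%N by apply/eqP; rewrite -(eqn_add2l #|S|) cardsC cS card_ord.
have /eqP/cards2P[a [b [ab SE]]] := cS.
have /eqP/cards2P[c [e [ce SE']]] := cS'.
pose f (i : 'I_4) := if i == o0 then a else if i == o1 then b else if i == o2 then c else e.
have aS x : (x \in S) = (x == a) || (x == b) by rewrite SE !inE.
have cSx x : (x \notin S) = (x == c) || (x == e) by rewrite -in_setC SE' !inE.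
have ain : a \in S by rewrite aS eqxx.
have bin : b \in S by rewrite aS eqxx orbT.
have cin : c \notin S by rewrite cSx eqxx.
have ein : e \notin S by rewrite cSx eqxx orbT.
have neq x y : x \in S -> y \notin S -> x <> y by move=> xS yS E; move: yS; rewrite -E xS.
have f_inj : injective f.
  move=> i j; elim/ord4P: i; elim/ord4P: j; rewrite /f //= => E.
  - by move/eqP: ab; rewrite E.
  - by case: (neq _ _ ain cin).
  - by case: (neq _ _ ain ein).
  - by move/eqP: ab; rewrite E.
  - by case: (neq _ _ bin cin).
  - by case: (neq _ _ bin ein).
  - by case: (neq _ _ ain cin).
  - by case: (neq _ _ bin cin).
  - by move/eqP: ce; rewrite E.
  - by case: (neq _ _ ain ein).
  - by case: (neq _ _ bin ein).
  - by move/eqP: ce; rewrite E.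
by exists (perm f_inj); rewrite /front !permE /f /= SE.
Qed.

End FourLegs.

Section Projections.
Variable C : numClosedFieldType.

(** An orthogonal projection is self-adjoint. *)
Lemma proj_ortho_adj m n (U : 'M[C]_(m, n)) (u : 'rV[C]_n) :
  (u <= U)%MS -> proj_ortho U *m u^t* = u^t*.
Proof.
move=> uU.
have h : (1%:M - proj_ortho U) *m u^t* = 0.
  apply/orthomx1P; have := proj_ortho_compl_sub U (1%:M : 'M_n); rewrite mul1mx => h.
  by apply: submx_trans h _; rewrite submx_ortho //.
by apply/eqP; rewrite eq_sym -subr_eq0 -{1}[u^t*]mul1mx -mulmxBl h.
Qed.

Lemma proj_ortho_eq0 m n (U : 'M[C]_(m, n)) : U = 0 -> proj_ortho U = 0.
Proof. by move=> ->; apply/eqP; rewrite -submx0 proj_orthoE submx0. Qed.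

Lemma big_mulmx0 n (I : eqType) (r : seq I) (P : pred I) (F : I -> 'M[C]_n) i :
  i \in r -> P i -> F i = 0 -> \big[mulmx/1%:M]_(j <- r | P j) F j = 0.
Proof.
elim: r => // j r IH; rewrite inE big_cons => /predU1P[<-|ir] Pi Fi.
  by rewrite Pi Fi mul0mx.
by case: (P j); rewrite IH // mulmx0.
Qed.

End Projections.

Section PartitionEntropy.
Variable R : realType.

Lemma log2_le (x y : R) : 0 < x -> x <= y -> log2 x <= log2 y.
Proof.
move=> x0 xy; rewrite /log2 ler_pM2r ?invr_gt0 ?ln2_gt0 //.
by rewrite ler_ln ?posrE // (lt_le_trans x0).
Qed.

Lemma part_entropy_le n lam : (0 < n)%N -> is_part n lam ->
  part_entropy R n lam <= log2 (size lam)%:R.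
Proof.
move=> n0 /and3P[_ _ /eqP sumlam].
have np : 0 < n%:R :> R by rewrite ltr0n.
pose p (i : 'I_(size lam)) : R := (nth 0%N lam i)%:R / n%:R.
have -> : part_entropy R n lam = shannon [seq p i | i : 'I_(size lam)].
  rewrite /part_entropy /shannon; congr (- _).
  by rewrite big_map (big_nth 0%N) big_mkord [RHS]big_image.
have s0 : (0 < size lam)%N by case: (lam) sumlam => //= n0'; rewrite -n0' in n0.
apply: shannon_le_log => //.
- by move=> i; rewrite /p divr_ge0.
- rewrite -mulr_suml -natr_sum (_ : (\sum_i _)%N = n) ?divff ?gt_eqF //.
  by rewrite -[RHS]sumlam sumnE (big_nth 0%N) big_mkord.
by rewrite (leq_trans (max_card _)) // card_ord.
Qed.

Lemma part_entropy_nseq r m : (0 < r)%N -> (0 < m)%N ->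
  part_entropy R (r * m) (nseq r m) = log2 r%:R.
Proof.
move=> r0 m0; rewrite /part_entropy map_nseq /shannon.
have -> : m%:R / (r * m)%:R = r%:R^-1 :> R.
  by rewrite natrM invfM mulrCA divff ?mulr1 // pnatr_eq0 -lt0n.
rewrite big_nseq iter_addr addr0 /log2 lnV ?posrE ?ltr0n // mulNr mulrN mulNrn opprK.
by rewrite -[_ *+ r]mulr_natl mulrA mulfV ?mul1r // pnatr_eq0 -lt0n.
Qed.

Lemma is_part_nseq r m : (0 < m)%N -> is_part (r * m) (nseq r m).
Proof.
move=> m0; apply/and3P; split; last by rewrite sumn_nseq mulnC.
- by case: r => //= r; elim: r => //= r ->; rewrite /geq /= leqnn.
by rewrite mem_nseq negb_and -[0%N == m]eq_sym -lt0n m0 orbT.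
Qed.

End PartitionEntropy.

(** * The two functionals *)

Section Functionals.
Variables (R : realType) (d : nat).
Hypothesis hd : (1 < d)%N.
Local Notation C := R[i].
Local Notation N := (d * d)%N.
Implicit Types (theta : bipartition 4 -> R) (psi : 'rV[C]_#|{: idx 4 d}|).

Lemma d_gt0 : (0 < d)%N. Proof. exact: ltnW. Qed.

Definition max_entropy (b0 b : bipartition 4) : R :=
  if b == b0 then log2 (d ^ 2)%:R else log2 d%:R.

(** The types of the determinant as a tensor, for the balanced bipartition b0 and for
    the singletons. *)
Definition rect_part (b0 b : bipartition 4) : seq nat :=
  if b == b0 then nseq N 1%N else nseq d d.

(** Partitions that occur have at most d^4 rows. *)
Lemma upper_set_bounded theta psi : is_distribution theta -> has_ubound
  [set h | exists n : nat, exists lam : bipartition 4 -> seq nat,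
    [/\ (0 < n)%N,
        {in supp theta, forall b, is_part n (lam b)},
        tensor_power n psi
          *m \big[mulmx/1%:M]_(b in supp theta) bip_proj R d n b (lam b) != 0
      & h = \sum_(b in supp theta) theta b * part_entropy R n (lam b)]]%classic.
Proof.
move=> [t0 _]; exists (\sum_(b in supp theta) theta b * log2 (d ^ 4)%:R).
move=> _ [n [lam [n0 part nz ->]]]; apply: ler_sum => b bs; rewrite ler_wpM2l //.
have bp0 : bip_proj R d n b (lam b) != 0.
  apply: contraNneq nz => bp0; rewrite (big_mulmx0 (mem_index_enum b) bs bp0).
  by rewrite mulmx0.
have iso0 : isotypic (permute_repr R d n (side b)) (lam b) != 0.
  apply: contraNneq bp0 => iso0.
  by rewrite /bip_proj /isotypic_proj (proj_ortho_eq0 iso0) mulmx0.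
apply: le_trans (part_entropy_le R n0 (part b bs)) _; apply: log2_le.
  rewrite ltr0n; case/and3P: (part b bs) => _ _ /eqP sn.
  by case: (lam b) sn => //= n0'; rewrite -n0' in n0.
rewrite ler_nat (leq_trans (isotypic_size (part b bs) iso0)) // leq_pexp2l ?d_gt0 //.
by rewrite (leq_trans (max_card _)) // card_ord.
Qed.

Lemma bip_proj_fix (b : bipartition 4) n lam (u : 'rV[C]_#|{: pow_idx 4 d n}|) :
  (u <= rfix_mx (permute_repr R d n [set: 'I_4]%SET) [set: 'S_n]%SET)%MS ->
  (u <= isotypic (permute_repr R d n (side b)) lam)%MS ->
  bip_proj R d n b lam *m u^t* = u^t*.
Proof.
by move=> fu iu; rewrite /bip_proj -mulmxA (proj_ortho_adj iu) (proj_ortho_adj fu).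
Qed.

Lemma cell_vec_tr (s : 'S_4) : (cell_vec R d s)^t* = (cell_vec R d s)^T.
Proof. by rewrite -map_trmx biantisym_real. Qed.

Lemma cell_vec_bip_proj theta (b0 : bipartition 4) (s : 'S_4) :
  side b0 = front s ->
  {in supp theta, forall b, b != b0 -> singleton_bipartition b} ->
  (\big[mulmx/1%:M]_(b in supp theta) bip_proj R d N b (rect_part b0 b)) *m (cell_vec R d s)^T
   = (cell_vec R d s)^T.
Proof.
move=> sb0 single; rewrite -cell_vec_tr.
elim/big_ind: _ => [|A B AE BE|b bs]; first by rewrite mul1mx.
  by rewrite -mulmxA BE.
apply: bip_proj_fix; first exact: cell_vec_fixed.
rewrite /rect_part; case: eqVneq => [->|bb0]; first by rewrite sb0 cell_vec_front.
have := single b bs bb0; rewrite singleton_side => /orP[]/cards1P[j E].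
  by apply: (@cell_vec_leg _ _ _ j); left.
by apply: (@cell_vec_leg _ _ _ j); right; rewrite -E setCK.
Qed.

Lemma E_upper_ge theta psi (b0 : bipartition 4) (s : 'S_4) : is_distribution theta ->
  side b0 = front s ->
  {in supp theta, forall b, b != b0 -> singleton_bipartition b} ->
  pair_mx s psi \in unitmx ->
  \sum_(b in supp theta) theta b * max_entropy b0 b <= E_upper theta psi.
Proof.
move=> dt sb0 single uM; apply: ub_le_sup; first exact: upper_set_bounded.
exists N, (rect_part b0); split.
- by rewrite muln_gt0 d_gt0.
- move=> b _; rewrite /rect_part; case: eqP => _; last by rewrite is_part_nseq ?d_gt0.
  by rewrite -{1}[N]muln1 is_part_nseq.
- apply: contraTneq uM => E.
  have := cell_vec_pairing s psi; rewrite -(cell_vec_bip_proj sb0 single) mulmxA E mul0mx mxE.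
  move/esym/eqP; rewrite mulf_eq0 pnatr_eq0 (gtn_eqF (fact_gt0 _)) /= => /eqP dM.
  by rewrite unitmxE unitfE dM eqxx.
apply: eq_bigr => b _; congr (_ * _); rewrite /max_entropy /rect_part; case: eqP => _.
  by rewrite -{1}[N]muln1 part_entropy_nseq ?muln_gt0 ?d_gt0 // mulnn.
by rewrite part_entropy_nseq ?d_gt0.
Qed.

(** The deficit comes from b0 alone; the other terms are bounded by their maxima. *)
Lemma E_lower_lt theta psi (b0 : bipartition 4) (s : 'S_4) : is_distribution theta ->
  side b0 = front s -> b0 \in supp theta ->
  {in supp theta, forall b, b != b0 -> singleton_bipartition b} ->
  obstruction (pair_mx s psi) != 0 ->
  E_lower theta psi < \sum_(b in supp theta) theta b * max_entropy b0 b.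
Proof.
move=> [t0 _] sb0 b0s single /(obstruction_neq0P hd)[uM rr'].
have [e e0 He] := H_bip_gap d_gt0 sb0 uM rr'.
have tb0 : 0 < theta b0 by rewrite lt_def t0 andbT; move: b0s; rewrite inE.
set B := \sum_(b in _) _; apply: (@le_lt_trans _ _ (B - theta b0 * e)); last first.
  by rewrite ltrBlDr ltrDl mulr_gt0.
have psi0 := pair_mx_unit_neq0 d_gt0 uM.
apply: ge_sup.
  exists (H_lower theta (tensor_act (fun=> 1%:M) psi)), (fun=> 1%:M) => //=.
  by move=> j; rewrite unitmx1.
move=> _ [A /= uA <-]; rewrite /H_lower (bigID (mem (supp theta))) /= [X in _ + X]big1 =>
  [|b]; last first.
  by rewrite inE negbK => /eqP->; rewrite mul0r.
rewrite addr0 /B (bigD1 b0) //= [X in _ <= X - _](bigD1 b0) //= addrAC -mulrBr.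
apply: lerD; first by rewrite ler_wpM2l // /max_entropy eqxx He.
apply: ler_sum => b /andP[bs bb0]; rewrite ler_wpM2l // /max_entropy (negPf bb0).
apply: (H_bip_le d_gt0 _ (erefl _)); first exact: tensor_act_eq0 d_gt0 _ _ uA psi0.
by rewrite -singleton_side; apply: single.
Qed.

Lemma generic_strict theta psi : (forall s : 'S_4, obstruction (pair_mx s psi) != 0) ->
  P_lam theta -> ~ P_s theta -> F_lower theta psi < F_upper theta psi.
Proof.
move=> gen [dt lam] notPs.
have [b0 b0s b0ns] : exists2 b, b \in supp theta & ~~ singleton_bipartition b.
  apply: contrapT => H; apply: notPs; split=> // b bs.
  by apply: contrapT => /negP h; apply: H; exists b.
have single : {in supp theta, forall b, b != b0 -> singleton_bipartition b}.
  move=> b bs; apply: contraNT => bns; apply/eqP.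
  exact: laminar_eq bns b0ns (lam _ _ bs b0s).
have [s sb0] := front_exists (side_card2 b0ns).1.
have uM : pair_mx s psi \in unitmx by have /(obstruction_neq0P hd)[] := gen s.
have psi0 := pair_mx_unit_neq0 d_gt0 uM.
rewrite /F_lower /F_upper (negPf psi0) /powR pnatr_eq0 /= ltr_expR ltr_pM2r ?ln2_gt0 //.
apply: lt_le_trans (E_upper_ge dt (esym sb0) single uM).
exact: E_lower_lt dt (esym sb0) b0s single (gen s).
Qed.

End Functionals.


Local Open Scope classical_set_scope.
Local Open Scope complex_scope.

(* R[i]^o carries the topology of the norm (modulus); the row vectors over it
   carry the product topology, i.e. the Euclidean one. *)
Theorem corollary3p13 (R : realType) (d : nat) (hd : (2 <= d)%N) :
  exists U : set 'rV[(R[i])^o]_#|{: idx 4 d}|,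
    [/\ open U, dense U &
        U `<=` [set psi : 'rV[R[i]]_#|{: idx 4 d}| |
                 forall theta : bipartition 4 -> R,
                   P_lam theta -> ~ P_s theta ->
                   F_lower theta psi < F_upper theta psi]].
Proof.
exists (@generic_set R d); have [oU dU] := generic_set_open_dense R hd; split => //.
by move=> psi gen theta; apply: generic_strict.
Qed.
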